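(* Let $D\subset\mathbb{R}^P$ be compact and let $A(\mu)=\theta_1(\mu)A_1+\dots+\theta_Q(\mu)A_Q$ for $\mu\in D$, with Hermitian $A_1,\dots,A_Q\in\mathbb{C}^{N\times N}$ and functions $\theta_1,\dots,\theta_Q:D\to\mathbb{R}$. Let $C_J=\{\mu_1,\dots,\mu_J\}\subset D$ be finite, let $\ell,r\ge1$, and let $\lambda_{\mathrm{SLB}}(\mu;C_J,\ell)$ be the subspace lower bound defined in the context (under the standing assumptions listed there). Let $\mu_i\in C_J$ lie in the interior of $D$, assume that $\theta_1,\dots,\theta_Q$ are differentiable at $\mu_i$ and that $\lambda_i=\lambda_{\min}(A(\mu_i))$ is a simple eigenvalue of $A(\mu_i)$. Suppose additionally that $r\le\ell$ and $\lambda_i^{(r+1)}>\lambda_i^{(r)}$. Then $$\nabla\lambda_{\mathrm{SLB}}(\mu_i;C_J,\ell)=\nabla\lambda_{\min}(A(\mu_i)),$$ where $\nabla$ denotes the gradient with respect to $\mu$, evaluated at $\mu=\mu_i$.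
   Context: Notation: $\theta(\mu)=[\theta_1(\mu),\dots,\theta_Q(\mu)]^T$; $\lambda_{\min},\lambda_{\max}$ are the extreme eigenvalues of a Hermitian matrix. For each $j=1,\dots,J$, $\lambda_j=\lambda_j^{(1)}\le\lambda_j^{(2)}\le\cdots$ are the eigenvalues of $A(\mu_j)$ in increasing order with multiplicity, $v_j^{(1)},\dots,v_j^{(\ell)}$ are orthonormal eigenvectors for the $\ell$ smallest ones ($\ell+1\le N$), $\Lambda_j=\mathrm{diag}(\lambda_j^{(1)},\dots,\lambda_j^{(\ell)})$ and $V_j=[v_j^{(1)},\dots,v_j^{(\ell)}]$. Subspace: $\mathcal{V}=\mathcal{V}(C_J,\ell)=\mathrm{span}\{v_j^{(k)}:1\le j\le J,1\le k\le\ell\}$, $d=\dim\mathcal{V}$, and $V\in\mathbb{C}^{N\times d}$ has orthonormal columns spanning $\mathcal{V}$. Fix an integer $1\le r\le d$, $r<N$. For $\mu\in D$ let $\lambda_{\mathcal V}^{(1)}(\mu)\le\cdots\le\lambda_{\mathcal V}^{(r)}(\mu)$ be the $r$ smallest eigenvalues of $V^*A(\mu)V$ with orthonormal eigenvectors $w_1,\dots,w_r\in\mathbb{C}^d$; let $\mathcal{U}(\mu)=\mathrm{span}\{Vw_1,\dots,Vw_r\}$, let $U\in\mathbb{C}^{N\times r}$ be an orthonormal basis of $\mathcal{U}(\mu)$, and let $\rho=\rho(\mu)=\|A(\mu)U-U(U^*A(\mu)U)\|_2$ (spectral norm). Linear program: $\mathcal{B}=\prod_{q=1}^Q[\lambda_{\min}(A_q),\lambda_{\max}(A_q)]$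 and $\mathcal{Y}_{\mathrm{LB}}(C_J)=\{y\in\mathcal{B}:\theta(\mu_j)^Ty\ge\lambda_j,\ j=1,\dots,J\}$. This polytope is described by $2Q+J$ constraints: the $2Q$ box constraints $y_q\ge\lambda_{\min}(A_q)$, $-y_q\ge-\lambda_{\max}(A_q)$, and the $J$ non-box constraints $\theta(\mu_j)^Ty\ge\lambda_j$. Standing assumption: $\mathcal{Y}_{\mathrm{LB}}(C_J)$ is a simple polytope with no degenerate facets, i.e. at each vertex exactly $Q$ of the $2Q+J$ constraints are active and these are linearly independent. For $\mu\in D$ let $y_\mu$ be a vertex of $\mathcal{Y}_{\mathrm{LB}}(C_J)$ minimizing $\theta(\mu)^Ty$ over $\mathcal{Y}_{\mathrm{LB}}(C_J)$, and write its $Q$ active constraints as $\Theta y_\mu=\psi$, with $\Theta\in\mathbb{R}^{Q\times Q}$ invertible and $\psi\in\mathbb{R}^Q$. Standing assumption: at least one of these active constraints is a non-box constraint. Definition of $\eta(\mu)$: for each $j$ let $\beta_j=\beta_j(\mu)$ be the smallest eigenvalue of the matrix $(\Lambda_j-\lambda_jI_\ell)-V_j^*UU^*V_j(\Lambda_j-\lambda_j^{(\ell+1)}I_\ell)$ (whose eigenvalues are real). Define $\tilde\psi$ by $\tilde\psi_k=\lambda_j+\beta_j$ if the $k$th equation of $\Theta y_\mu=\psi$ is the non-box constraint $\theta(\mu_j)^Ty=\lambda_j$, and $\tilde\psi_k=\psi_k$ if it is a box constraint. Set $\eta(\mu)=\theta(\mu)^T\Theta^{-1}\tilde\psi$. Subspace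 lower bound: $$\lambda_{\mathrm{SLB}}(\mu;C_J,\ell)=\min\big(\lambda_{\mathcal V}^{(1)}(\mu),\eta(\mu)\big)-\frac{2\rho^2}{|\lambda_{\mathcal V}^{(1)}(\mu)-\eta(\mu)|+\sqrt{|\lambda_{\mathcal V}^{(1)}(\mu)-\eta(\mu)|^2+4\rho^2}},$$ where the fraction is read as $0$ if $\rho=0$. *)

(* Defs.v *)
From HB Require Import structures.
From mathcomp Require Import all_boot all_order all_algebra.
From mathcomp Require Import all_classical all_reals all_analysis.
From mathcomp Require Import complex spectral sesquilinear.
Set Implicit Arguments.
Unset Strict Implicit.
Unset Printing Implicit Defensive.
Import Order.TTheory GRing.Theory Num.Theory.
Import numFieldNormedType.Exports.
Local Open Scope ring_scope.
Local Open Scope classical_set_scope.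
Local Open Scope sesquilinear_scope.
Local Open Scope complex_scope.

Section Eigenvalues.
Context {R : realType}.
Local Notation C := (R[i]).

(* Roots of the characteristic polynomial, with multiplicity, in increasing
   order.  Taking real parts loses nothing for a matrix with real spectrum,
   the only case in which this is used below. *)
Definition eigvals n (M : 'M[C]_n) : seq R :=
  sort <=%R
    [seq complex.Re z | z <- sval (closed_field_poly_normal (char_poly M))].

(* k-th smallest eigenvalue, 1 <= k <= n; numbering starts at 1. *)
Definition eig n (M : 'M[C]_n) (k : nat) : R := nth 0 (eigvals M) k.-1.

Definition lambda_min n (M : 'M[C]_n) : R := eig M 1.
Definition lambda_max n (M : 'M[C]_n) : R := eig M n.

(* Algebraic multiplicity one. *)
Definition simple_eigenvalue n (M : 'M[C]_n) (a : R) : Prop :=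
  mup a%:C (char_poly M) = 1%N.

(* Largest singular value. *)
Definition spectral_norm m n (M : 'M[C]_(m, n)) : R :=
  Num.sqrt (lambda_max (M^t* *m M)).

Definition orthonormal_cols m n (M : 'M[C]_(m, n)) : Prop :=
  M^t* *m M = 1%:M.

Definition eig_diag n (M : 'M[C]_n) (k : nat) : 'M[C]_k :=
  diag_mx (\row_(j < k) (eig M j.+1)%:C).

(* The columns of W are orthonormal eigenvectors of M for its k smallest
   eigenvalues, in increasing order. *)
Definition smallest_eigvecs n k (M : 'M[C]_n) (W : 'M[C]_(n, k)) : Prop :=
  orthonormal_cols W /\ M *m W = W *m eig_diag M k.

End Eigenvalues.

Section Gradient.
Context {R : realType} {P : nat}.

Definition grad (f : 'rV[R]_P -> R) (x : 'rV[R]_P) : 'rV[R]_P :=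
  \row_(k < P) 'D_(delta_mx 0 k) f x.

End Gradient.

Section Vertices.
Context {R : realType} {Q : nat}.

(* Vertices of a polytope, as its extreme points. *)
Definition is_vertex (S : set 'cV[R]_Q) (y : 'cV[R]_Q) : Prop :=
  S y /\ forall (a b : 'cV[R]_Q) (t : R), S a -> S b -> 0 < t < 1 ->
    y = t *: a + (1 - t) *: b -> a = b.

End Vertices.

Section SubspaceLowerBound.
Context {R : realType} {P Q N J : nat}.
Local Notation C := (R[i]).
(* Only the values of theta on the parameter domain matter. *)
Variables (A : 'I_Q -> 'M[C]_N) (theta : 'I_Q -> 'rV[R]_P -> R).
Variable mus : 'I_J -> 'rV[R]_P.

Definition Amu (mu : 'rV[R]_P) : 'M[C]_N :=
  \sum_(q < Q) (theta q mu)%:C *: A q.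

Definition theta_row (mu : 'rV[R]_P) : 'rV[R]_Q := \row_(q < Q) theta q mu.

(* The 2Q + J constraints, each read as row * y >= rhs: inl (inl q) is the
   lower and inl (inr q) the upper box constraint on y_q; inr j is the
   constraint coming from the j-th sample point. *)
Definition constr : finType := ('I_Q + 'I_Q + 'I_J)%type.

Definition constr_row (c : constr) : 'rV[R]_Q :=
  match c with
  | inl (inl q) => delta_mx 0 q
  | inl (inr q) => - delta_mx 0 q
  | inr j => theta_row (mus j)
  end.

Definition constr_rhs (c : constr) : R :=
  match c with
  | inl (inl q) => lambda_min (A q)
  | inl (inr q) => - lambda_max (A q)
  | inr j => lambda_min (Amu (mus j))
  end.

Definition box : set 'cV[R]_Q :=
  [set y | forall q, lambda_min (A q) <= y q 0 <= lambda_max (A q)].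

Definition Y_LB : set 'cV[R]_Q :=
  [set y | box y /\
    forall j, (theta_row (mus j) *m y) 0 0 >= lambda_min (Amu (mus j))].

Definition active (y : 'cV[R]_Q) : {set constr} :=
  [set c : constr | (constr_row c *m y) 0 0 == constr_rhs c]%SET.

Definition simple_nondegenerate : Prop :=
  forall y, is_vertex Y_LB y ->
    #|active y| = Q /\
    row_free (\matrix_(k < #|active y|) constr_row (enum_val k)).

Definition LP_vertex (mu : 'rV[R]_P) (y : 'cV[R]_Q) : Prop :=
  is_vertex Y_LB y /\
  forall z, Y_LB z -> (theta_row mu *m y) 0 0 <= (theta_row mu *m z) 0 0.

(* An ordering of the active constraints at y as Q equations. *)
Definition active_enum (y : 'cV[R]_Q) (act : 'I_Q -> constr) : Prop :=
  injective act /\ forall c, (c \in active y) = (c \in codom act).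

Definition Theta (act : 'I_Q -> constr) : 'M[R]_Q :=
  \matrix_(k < Q) constr_row (act k).

Variables (l r : nat).

(* vs j is V_j. *)
Variable vs : 'I_J -> 'M[C]_(N, l).

(* V has orthonormal columns spanning the sum of the column spaces of the V_j;
   column spaces are row spaces of transposes. *)
Definition subspace_basis d (V : 'M[C]_(N, d)) : Prop :=
  orthonormal_cols V /\ (V^T :=: \sum_(j < J) <<(vs j)^T>>)%MS.

Definition projected d (V : 'M[C]_(N, d)) (mu : 'rV[R]_P) : 'M[C]_d :=
  V^t* *m Amu mu *m V.

(* U is an orthonormal basis of a Ritz space U(mu): the image under V of the
   span of orthonormal eigenvectors w_1, ..., w_r of the projected matrix. *)
Definition ritz_basis d (V : 'M[C]_(N, d)) (mu : 'rV[R]_P)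
    (W : 'M[C]_(d, r)) (U : 'M[C]_(N, r)) : Prop :=
  [/\ smallest_eigvecs (projected V mu) W,
      orthonormal_cols U & (U^T :=: (V *m W)^T)%MS].

Definition rho (U : 'M[C]_(N, r)) (mu : 'rV[R]_P) : R :=
  spectral_norm (Amu mu *m U - U *m (U^t* *m Amu mu *m U)).

Definition beta_mx (U : 'M[C]_(N, r)) (j : 'I_J) : 'M[C]_l :=
  let M := Amu (mus j) in
  (eig_diag M l - (lambda_min M)%:C%:M)
  - (vs j)^t* *m U *m U^t* *m vs j *m (eig_diag M l - (eig M l.+1)%:C%:M).

(* beta_mx need not be Hermitian, but its spectrum is real. *)
Definition beta (U : 'M[C]_(N, r)) (j : 'I_J) : R := lambda_min (beta_mx U j).

Definition psi_tilde (U : 'M[C]_(N, r)) (act : 'I_Q -> constr) : 'cV[R]_Q :=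
  \col_(k < Q)
    match act k with
    | inr j => lambda_min (Amu (mus j)) + beta U j
    | inl _ => constr_rhs (act k)
    end.

Definition eta (U : 'M[C]_(N, r)) (act : 'I_Q -> constr) (mu : 'rV[R]_P) : R :=
  (theta_row mu *m invmx (Theta act) *m psi_tilde U act) 0 0.

(* If rho = 0 the fraction is 0, also when its denominator vanishes. *)
Definition lambda_SLB d (V : 'M[C]_(N, d)) (U : 'M[C]_(N, r))
    (act : 'I_Q -> constr) (mu : 'rV[R]_P) : R :=
  let lV := lambda_min (projected V mu) in
  let e := eta U act mu in
  let p := rho U mu in
  Num.min lV e
  - 2 * p ^+ 2 / (`|lV - e| + Num.sqrt (`|lV - e| ^+ 2 + 4 * p ^+ 2)).

End SubspaceLowerBound.

(* Main.v *)
(* Let [mu_i = mus i], [A0 = A(mu_i)], [E = A(mu) - A0], and let [v] be the unit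
   eigenvector for the smallest eigenvalue of [A0].  Both [lmin] and [slb] agree
   with [phi mu = v^* A(mu) v] up to [O(|mu - mu_i|^2)], so near [mu_i] they
   inherit the derivative of [phi], which is linear in the [theta q].
   - [lmin <= lambda_V^(1) <= phi] by Rayleigh quotients, and simplicity of the
     eigenvalue gives [phi - O(|E|^2) <= lmin].
   - As [r <= l], the eigenspace of [A0] for its [r] smallest eigenvalues lies in
     the span of [V]; the gap after the r-th one makes the Ritz space at [mu]
     deviate from it, and its residual [rho] vanish, to order [O(|E|)].
   - The point [(v^* A_q v)_q] is feasible and makes the i-th sample constraint
     tight, so near [mu_i] every optimal vertex has this constraint active.
     Hence [eta(mu)] is close to [lambda_i + beta_i(mu)], and [beta_i(mu)] is
     close to [lambda_i^(r+1) - lambda_i] or larger: [eta - lambda_V^(1)] stays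
     away from 0, and [slb] differs from [lambda_V^(1)] by [O(rho^2)]. *)
Require Import Defs.
From HB Require Import structures.
From mathcomp Require Import all_boot all_order all_fingroup all_algebra.
From mathcomp Require Import all_classical all_reals all_analysis.
From mathcomp Require Import complex spectral sesquilinear.
From mathcomp Require Import ring lra.
Import Order.TTheory GRing.Theory Num.Theory.
Import numFieldNormedType.Exports.
Local Open Scope ring_scope.
Local Open Scope classical_set_scope.

Set Implicit Arguments.
Unset Strict Implicit.
Unset Printing Implicit Defensive.

(** * Frobenius product and entrywise norm *)

Section ComplexMatrices.
Local Open Scope sesquilinear_scope.
Local Open Scope complex_scope.
Context {R : realType}.
Local Notation C := (R[i]).
Local Notation Re := (@complex.Re R).
Local Notation normc := (@Normc.normc R).

Lemma ReD (x y : C) : Re (x + y) = Re x + Re y.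
Proof. by case: x y => [a b] [c d]. Qed.

Lemma ReN (x : C) : Re (- x) = - Re x.
Proof. by case: x. Qed.

Lemma Re_sum (I : Type) (s : seq I) (p : pred I) (F : I -> C) :
  Re (\sum_(i <- s | p i) F i) = \sum_(i <- s | p i) Re (F i).
Proof. exact: (big_morph _ ReD (erefl _)). Qed.

Lemma ReZ (a : R) (x : C) : Re (a%:C * x) = a * Re x.
Proof. by case: x => b c; rewrite /= mul0r subr0. Qed.

Lemma Re_conj (x : C) : Re (x^*)%R = Re x.
Proof. by case: x. Qed.

Lemma Re_conjM (x : C) : Re ((x^*)%R * x) = normc x ^+ 2.
Proof.
by case: x => a b /=; rewrite sqr_sqrtr ?addr_ge0 ?sqr_ge0 // mulNr opprK -!expr2.
Qed.

Lemma normr_normc (x : C) : `|x| = (normc x)%:C.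
Proof. by []. Qed.

Lemma normc_ge0 (x : C) : 0 <= normc x.
Proof. by case: x => a b /=; rewrite sqrtr_ge0. Qed.

Lemma normcD (x y : C) : normc (x + y) <= normc x + normc y.
Proof. by rewrite -lecR rmorphD /= -!normr_normc ler_normD. Qed.

Lemma normc_sum (I : Type) (s : seq I) (p : pred I) (F : I -> C) :
  normc (\sum_(i <- s | p i) F i) <= \sum_(i <- s | p i) normc (F i).
Proof.
elim/big_ind2: _ => [|x1 x2 y1 y2 h1 h2|//]; first by rewrite Normc.normc0.
exact: le_trans (normcD _ _) (lerD h1 h2).
Qed.

Lemma normcN (x : C) : normc (- x) = normc x.
Proof. by apply: complexI; rewrite -!normr_normc normrN. Qed.

Lemma normc_conj (x : C) : normc (x^*)%R = normc x.
Proof. by apply: complexI; rewrite -!normr_normc norm_conjC. Qed.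

Lemma normc_real (a : R) : normc a%:C = `|a|.
Proof. by rewrite /= expr0n /= addr0 sqrtr_sqr. Qed.

Lemma le_Re_normc (x : C) : `|Re x| <= normc x.
Proof. by rewrite -lecR; exact: normc_ge_Re. Qed.

Lemma adjM m n p (M : 'M[C]_(m, n)) (K : 'M[C]_(n, p)) :
  (M *m K)^t* = K^t* *m M^t*.
Proof. by rewrite trmx_mul map_mxM. Qed.

Lemma adjD m n (M K : 'M[C]_(m, n)) : (M + K)^t* = M^t* + K^t*.
Proof. by rewrite linearD /= map_mxD. Qed.

Lemma adjB m n (M K : 'M[C]_(m, n)) : (M - K)^t* = M^t* - K^t*.
Proof. by rewrite linearB /= map_mxB. Qed.

Lemma hermsymmxE n (M : 'M[C]_n) : (M \is hermsymmx) = (M^t* == M).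
Proof. by rewrite is_hermitianmxE expr0 scale1r eq_sym. Qed.

Lemma adj_herm n (M : 'M[C]_n) : M \is hermsymmx -> M^t* = M.
Proof. by rewrite hermsymmxE => /eqP. Qed.

Lemma herm_congr n m (M : 'M[C]_n) (K : 'M[C]_(n, m)) :
  M \is hermsymmx -> K^t* *m M *m K \is hermsymmx.
Proof.
by move=> hM; rewrite hermsymmxE !adjM trmxCK (adj_herm hM) mulmxA.
Qed.

(* The real part makes the Frobenius product symmetric and R-bilinear. *)
Definition ip m n (M K : 'M[C]_(m, n)) : R := Re (\tr (M^t* *m K)).

Lemma ipE m n (M K : 'M[C]_(m, n)) :
  ip M K = \sum_j \sum_i Re ((M i j)^* * K i j)%R.
Proof.
rewrite /ip /mxtrace Re_sum; apply: eq_bigr => j _.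
by rewrite mxE Re_sum; apply: eq_bigr => i _; rewrite !mxE.
Qed.

Lemma ip_sqE m n (M : 'M[C]_(m, n)) :
  ip M M = \sum_j \sum_i normc (M i j) ^+ 2.
Proof.
by rewrite ipE; apply: eq_bigr => j _; apply: eq_bigr => i _; rewrite Re_conjM.
Qed.

Lemma ipC m n (M K : 'M[C]_(m, n)) : ip M K = ip K M.
Proof.
rewrite !ipE; apply: eq_bigr => j _; apply: eq_bigr => i _.
by rewrite -[LHS]Re_conj rmorphM /= conjCK mulrC.
Qed.

Lemma ipDr m n (M K L : 'M[C]_(m, n)) : ip M (K + L) = ip M K + ip M L.
Proof. by rewrite /ip mulmxDr linearD /= ReD. Qed.

Lemma ipNr m n (M K : 'M[C]_(m, n)) : ip M (- K) = - ip M K.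
Proof. by rewrite /ip mulmxN linearN /= ReN. Qed.

Lemma ipBr m n (M K L : 'M[C]_(m, n)) : ip M (K - L) = ip M K - ip M L.
Proof. by rewrite ipDr ipNr. Qed.

Lemma ipDl m n (M K L : 'M[C]_(m, n)) : ip (M + K) L = ip M L + ip K L.
Proof. by rewrite ipC ipDr !(ipC L). Qed.

Lemma ipNl m n (M K : 'M[C]_(m, n)) : ip (- M) K = - ip M K.
Proof. by rewrite ipC ipNr ipC. Qed.

Lemma ipBl m n (M K L : 'M[C]_(m, n)) : ip (M - K) L = ip M L - ip K L.
Proof. by rewrite ipDl ipNl. Qed.

Lemma ipZr m n (M K : 'M[C]_(m, n)) (a : R) : ip M (a%:C *: K) = a * ip M K.
Proof. by rewrite /ip -scalemxAr mxtraceZ ReZ. Qed.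

Lemma ip0r m n (M : 'M[C]_(m, n)) : ip M 0 = 0.
Proof. by rewrite /ip mulmx0 mxtrace0. Qed.

Lemma ip_mulmxl m n p (M : 'M[C]_(m, n)) (K : 'M[C]_(n, p)) (L : 'M[C]_(m, p)) :
  ip (M *m K) L = ip K (M^t* *m L).
Proof. by rewrite /ip adjM mulmxA. Qed.

Lemma ip_mulmxr m n p (M : 'M[C]_(m, n)) (K : 'M[C]_(n, p)) (L : 'M[C]_(m, p)) :
  ip (M *m K) L = ip M (L *m K^t*).
Proof. by rewrite /ip adjM -mulmxA mxtrace_mulC mulmxA. Qed.

Lemma ip_ge0 m n (M : 'M[C]_(m, n)) : 0 <= ip M M.
Proof. by rewrite ip_sqE; do 2!apply: sumr_ge0 => ? _; rewrite sqr_ge0. Qed.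

Lemma normc_ip m n (M : 'M[C]_(m, n)) i j : normc (M i j) ^+ 2 <= ip M M.
Proof.
rewrite ip_sqE (bigD1 j) //= (bigD1 i) //= -addrA lerDl addr_ge0 //.
  by apply: sumr_ge0 => ? _; rewrite sqr_ge0.
by do 2!apply: sumr_ge0 => ? _; rewrite sqr_ge0.
Qed.

Lemma ip_eq0 m n (M : 'M[C]_(m, n)) : ip M M <= 0 -> M = 0.
Proof.
move=> h; apply/matrixP => i j; rewrite mxE; apply: Normc.eq0_normc.
apply/eqP; rewrite -sqrf_eq0; apply/eqP/le_anti.
by rewrite (le_trans (normc_ip M i j) h) sqr_ge0.
Qed.

Lemma ip_isometry m n p (K : 'M[C]_(m, n)) (M L : 'M[C]_(n, p)) :
  orthonormal_cols K -> ip (K *m M) (K *m L) = ip M L.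
Proof. by move=> hK; rewrite ip_mulmxl mulmxA hK mul1mx. Qed.

Definition fnorm m n (M : 'M[C]_(m, n)) : R := Num.sqrt (ip M M).

Lemma fnorm_ge0 m n (M : 'M[C]_(m, n)) : 0 <= fnorm M.
Proof. exact: sqrtr_ge0. Qed.

Lemma sqr_fnorm m n (M : 'M[C]_(m, n)) : fnorm M ^+ 2 = ip M M.
Proof. by rewrite sqr_sqrtr ?ip_ge0. Qed.

Lemma normc_fnorm m n (M : 'M[C]_(m, n)) i j : normc (M i j) <= fnorm M.
Proof.
rewrite -(@ler_pXn2r _ 2) ?nnegrE ?fnorm_ge0 ?normc_ge0 // sqr_fnorm.
exact: normc_ip.
Qed.

(* Unlike the maximum norm, the entrywise l1 norm is submultiplicative. *)
Definition nrm m n (M : 'M[C]_(m, n)) : R := \sum_i \sum_j normc (M i j).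

Lemma nrm_ge0 m n (M : 'M[C]_(m, n)) : 0 <= nrm M.
Proof. by do 2!apply: sumr_ge0 => ? _; rewrite normc_ge0. Qed.

Lemma nrm_row m n (M : 'M[C]_(m, n)) i : \sum_j normc (M i j) <= nrm M.
Proof.
rewrite /nrm (bigD1 i) //= lerDl; do 2!apply: sumr_ge0 => ? _.
by rewrite normc_ge0.
Qed.

Lemma nrmD m n (M K : 'M[C]_(m, n)) : nrm (M + K) <= nrm M + nrm K.
Proof.
rewrite /nrm -big_split ler_sum // => i _; rewrite -big_split ler_sum // => j _.
by rewrite mxE normcD.
Qed.

Lemma nrmN m n (M : 'M[C]_(m, n)) : nrm (- M) = nrm M.
Proof. by do 2!apply: eq_bigr => ? _; rewrite mxE normcN. Qed.

Lemma nrmB m n (M K : 'M[C]_(m, n)) : nrm (M - K) <= nrm M + nrm K.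
Proof. by rewrite -(nrmN K) nrmD. Qed.

Lemma nrm0 m n : nrm (0 : 'M[C]_(m, n)) = 0.
Proof. by do 2!rewrite /nrm big1 // => ? _; rewrite mxE Normc.normc0. Qed.

Lemma nrmZ m n (a : C) (M : 'M[C]_(m, n)) : nrm (a *: M) = normc a * nrm M.
Proof.
rewrite /nrm mulr_sumr; apply: eq_bigr => i _; rewrite mulr_sumr.
by apply: eq_bigr => j _; rewrite mxE Normc.normcM.
Qed.

Lemma nrm_sum m n (I : finType) (F : I -> 'M[C]_(m, n)) :
  nrm (\sum_i F i) <= \sum_i nrm (F i).
Proof.
elim/big_ind2: _ => [|x1 x2 y1 y2 h1 h2|//]; first by rewrite nrm0.
exact: le_trans (nrmD _ _) (lerD h1 h2).
Qed.

Lemma nrm_adj m n (M : 'M[C]_(m, n)) : nrm (M^t*) = nrm M.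
Proof.
rewrite /nrm exchange_big; apply: eq_bigr => i _; apply: eq_bigr => j _.
by rewrite !mxE normc_conj.
Qed.

Lemma nrmM m n p (M : 'M[C]_(m, n)) (K : 'M[C]_(n, p)) :
  nrm (M *m K) <= nrm M * nrm K.
Proof.
rewrite /nrm mulr_suml ler_sum // => i _.
apply: (@le_trans _ _ (\sum_k \sum_j normc (M i j) * normc (K j k))).
  apply: ler_sum => k _; rewrite mxE; apply: le_trans (normc_sum _ _ _) _.
  by apply: ler_sum => j _; rewrite Normc.normcM.
rewrite exchange_big mulr_suml /= ler_sum // => j _; rewrite -mulr_sumr.
by rewrite ler_wpM2l ?normc_ge0 // nrm_row.
Qed.

Lemma nrm_fnorm m n (M : 'M[C]_(m, n)) : nrm M <= (m * n)%:R * fnorm M.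
Proof.
rewrite /nrm natrM -mulrA.
apply: (@le_trans _ _ (\sum_(i < m) \sum_(j < n) fnorm M)).
  by apply: ler_sum => i _; apply: ler_sum => j _; exact: normc_fnorm.
by rewrite !sumr_const !card_ord !mulr_natl.
Qed.

Lemma ip_nrm m n (M K : 'M[C]_(m, n)) : `|ip M K| <= nrm M * fnorm K.
Proof.
rewrite ipE /nrm exchange_big mulr_suml /=.
apply: le_trans (ler_norm_sum _ _ _) _; apply: ler_sum => j _.
rewrite mulr_suml; apply: le_trans (ler_norm_sum _ _ _) _; apply: ler_sum => i _.
apply: le_trans (le_Re_normc _) _; rewrite Normc.normcM normc_conj.
by rewrite ler_wpM2l ?normc_ge0 // normc_fnorm.
Qed.

Lemma ip_le_nrm2 m n (M : 'M[C]_(m, n)) : ip M M <= nrm M ^+ 2.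
Proof.
have := ip_nrm M M; have := nrm_ge0 M; have := fnorm_ge0 M.
rewrite -sqr_fnorm ger0_norm ?sqr_ge0 // => h1 h2 h3.
have : fnorm M <= nrm M by nra.
by move=> ?; nra.
Qed.

(** Every coordinate of a column is at most its Frobenius norm, so no dimension-dependent factor
    appears. This is the bound used for quadratic forms of the perturbation [E]. *)
Lemma ip_col_nrm n (x y : 'cV[C]_n) (M : 'M[C]_n) :
  `|ip x (M *m y)| <= nrm M * (fnorm x * fnorm y).
Proof.
rewrite ipE big_ord1 [leRHS]mulr_suml.
apply: le_trans (ler_norm_sum _ _ _) _; apply: ler_sum => i _.
apply: le_trans (le_Re_normc _) _.
rewrite Normc.normcM normc_conj mulrCA mxE ler_pM ?normc_ge0 ?normc_fnorm //.
apply: le_trans (normc_sum _ _ _) _; rewrite mulr_suml ler_sum // => j _.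
by rewrite Normc.normcM ler_wpM2l ?normc_ge0 // normc_fnorm.
Qed.

Lemma nrm_ortho m n (K : 'M[C]_(m, n)) : orthonormal_cols K -> nrm K <= (m * n)%:R.
Proof.
move=> hK; rewrite /nrm natrM.
apply: (@le_trans _ _ (\sum_(i < m) \sum_(j < n) 1)); last first.
  by rewrite !sumr_const !card_ord mulr_natl.
apply: ler_sum => i _; apply: ler_sum => j _.
rewrite -(@ler_pXn2r _ 2) ?nnegrE ?normc_ge0 // expr1n.
(* The column is [K] applied to a unit coordinate vector, whose squared norm the isometry preserves;
   each entry of a unit vector has modulus at most 1. *)
suff <- : ip (col j K) (col j K) = 1 by have := normc_ip (col j K) i 0; rewrite mxE.
rewrite colE ip_isometry // ip_sqE big_ord1 (bigD1 j) //= big1 => [|k /negbTE hk].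
  by rewrite mxE !eqxx Normc.normc1 expr1n addr0.
by rewrite mxE hk [(false && _)%:R]/= Normc.normc0 expr0n.
Qed.

End ComplexMatrices.

(** * Spectra of complex matrices *)

Section Spectrum.
Local Open Scope sesquilinear_scope.
Local Open Scope complex_scope.
Context {R : realType}.
Local Notation C := (R[i]).
Local Notation Re := (@complex.Re R).
Local Notation normc := (@Normc.normc R).

(** Both sides are compared after multiplication by the nonzero constant polynomial [\det P]; the
    intertwining form of the hypothesis avoids inverses. *)
Lemma char_poly_similar (F : fieldType) n (P M D : 'M[F]_n) :
  P \in unitmx -> P *m M = D *m P -> char_poly M = char_poly D.
Proof.
move=> uP hPM; apply: (@mulfI _ (\det (map_mx polyC P))).
  by rewrite det_map_mx polyC_eq0 -unitfE -unitmxE.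
rewrite /char_poly -det_mulmx [RHS]mulrC -det_mulmx; congr (\det _).
by rewrite mulmxBr mulmxBl scalar_mxC -!map_mxM hPM.
Qed.

Lemma char_poly_roots n (M : 'M[C]_n) :
  char_poly M = \prod_(z <- sval (closed_field_poly_normal (char_poly M)))
                  ('X - z%:P).
Proof.
case: closed_field_poly_normal => s /= hs.
by rewrite hs [in LHS](eqP (char_poly_monic M)) scale1r.
Qed.

Lemma size_eigvals n (M : 'M[C]_n) : size (eigvals M) = n.
Proof.
apply: succn_inj; rewrite size_sort size_map -(size_char_poly M).
by rewrite [in RHS]char_poly_roots size_prod_XsubC.
Qed.

Lemma eig_le n (M : 'M[C]_n) j k :
  (0 < j)%N -> (j <= k)%N -> (k <= n)%N -> eig M j <= eig M k.
Proof.
case: j k => [|j] [|k] //= _; rewrite ltnS => jk kn.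
apply: (sorted_leq_nth le_trans le_refl) => //.
- by apply: sort_sorted; exact: le_total.
- by rewrite inE size_eigvals (leq_ltn_trans jk kn).
- by rewrite inE size_eigvals.
Qed.

Lemma eig_root n (M : 'M[C]_n) k : (0 < k)%N -> (k <= n)%N ->
  exists2 z, root (char_poly M) z & eig M k = Re z.
Proof.
case: k => // k _ kn; have : eig M k.+1 \in eigvals M.
  by rewrite /eig mem_nth // size_eigvals.
rewrite mem_sort => /mapP[z hz ->]; exists z => //.
by rewrite char_poly_roots root_prod_XsubC.
Qed.

Lemma root_eigvec n (M : 'M[C]_n) z : root (char_poly M) z ->
  exists2 x : 'cV[C]_n, x != 0 & M *m x = z *: x.
Proof.
(* [eigenvalue] refers to row vectors, so a column eigenvector comes from the transpose, which has
   the same characteristic polynomial. *)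
move=> hz; have : root (char_poly M^T) z.
  rewrite (_ : char_poly M^T = char_poly M) // /char_poly -det_tr.
  by congr (\det _); rewrite /char_poly_mx linearB /= tr_scalar_mx -map_trmx trmxK.
rewrite -eigenvalue_root_char => /eigenvalueP[v hv v0].
exists v^T; first by rewrite trmx_eq0.
by rewrite -[M]trmxK -trmx_mul hv linearZ.
Qed.

(* Gershgorin's argument at the largest entry of an eigenvector. *)
Lemma root_char_poly_near_diag n (D E : 'M[C]_n) z :
  (forall i j, i != j -> D i j = 0) -> root (char_poly (D + E)) z ->
  exists k, normc (z - D k k) <= nrm E.
Proof.
move=> hD /root_eigvec[x x0 hx].
have [i0 hi0] : exists i0, x i0 0 != 0.
  apply/existsP; apply: contraNT x0 => /existsPn h; apply/eqP/matrixP => i j.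
  by rewrite ord1 mxE; apply/eqP; move: (h i); rewrite negbK.
case: (Order.TotalTheory.arg_maxP (fun i => normc (x i 0)) (erefl true : xpredT i0)) => k _ hk.
exists k; have pk : 0 < normc (x k 0).
  apply: lt_le_trans (hk i0 isT); rewrite lt_def normc_ge0 andbT.
  by apply: contraNneq hi0 => /Normc.eq0_normc ->.
rewrite -(ler_pM2r pk) -Normc.normcM.
have -> : (z - D k k) * x k 0 = \sum_j E k j * x j 0.
  have Dx : (D *m x) k 0 = D k k * x k 0.
    rewrite mxE (bigD1 k) //= big1 ?addr0 // => j; rewrite eq_sym => jk.
    by rewrite hD // mul0r.
  move/matrixP: hx => /(_ k 0); rewrite mulmxDl [LHS]mxE Dx [RHS]mxE mulrBl => <-.
  by rewrite addrAC subrr add0r mxE.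
apply: le_trans (normc_sum _ _ _) _; apply: (@le_trans _ _ (\sum_j normc (E k j) * normc (x k 0))).
  by apply: ler_sum => j _; rewrite Normc.normcM ler_wpM2l ?normc_ge0 //; exact: hk.
by rewrite -mulr_suml ler_wpM2r ?normc_ge0 // nrm_row.
Qed.

(** Gershgorin with zero diagonal part. In this generality it also applies to the matrices
    [beta_mx]. *)
Lemma eig_nrm n (M : 'M[C]_n) k : (0 < k)%N -> (k <= n)%N -> `|eig M k| <= nrm M.
Proof.
move=> k0 kn; have [z hz ->] := eig_root M k0 kn.
have [||i] := @root_char_poly_near_diag n 0 M z; first by move=> *; rewrite mxE.
  by rewrite add0r.
by rewrite mxE subr0; exact: le_trans (le_Re_normc _).
Qed.

(** The spectral theorem yields the eigenvalues in some unknown order. Comparing the linear factors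
    of the characteristic polynomial shows that [eigvals] is a permutation of them, and the same
    permutation applied to the eigenvectors gives [T]. *)
Lemma hermitian_eigenbasis n (M : 'M[C]_n) :
  M \is hermsymmx -> exists T : 'M[C]_n, smallest_eigvecs M T.
Proof.
move=> hM; set P := spectralmx M; set sp := spectral_diag M.
have uP : P \is unitarymx by exact: spectral_unitarymx.
have PP : P *m P^t* = 1%:M by apply/unitarymxP.
have hPM : M = P^t* *m diag_mx sp *m P.
  by rewrite -invmx_unitary //; apply/orthomx_spectralP/hermitian_normalmx.
have sp_real i : (Re (sp 0 i))%:C = sp 0 i.
  by apply: RRe_real; apply: (mxOverP (hermitian_spectral_diag_real hM)).
have : perm_eq (eigvals M) [tuple Re (sp 0 i) | i < n].
  rewrite perm_sort -[X in perm_eq _ X]/(map _ _) (map_comp Re (fun i => sp 0 i)).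
  apply: perm_map; apply: prod_XsubC_eq; rewrite -char_poly_roots.
  rewrite (@char_poly_similar _ _ P M (diag_mx sp)).
  - rewrite char_poly_trig ?diag_mx_is_trig // big_map big_enum /=.
    by apply: eq_bigr => i _; rewrite mxE eqxx.
  - exact: unitarymx_unit.
  - by rewrite {1}hPM !mulmxA PP mul1mx.
case/tuple_permP => p hp; exists (\matrix_(i, j) P^t* i (p j)).
have eigE (j : 'I_n) : (eig M j.+1)%:C = sp 0 (p j).
  rewrite /eig hp /= -[nth _ _ _]/(nth 0 (map _ _) _).
  rewrite (nth_map j) ?size_enum_ord // nth_ord_enum tnth_map tnth_ord_tuple.
  exact: sp_real.
split.
  apply/matrixP => i j; rewrite !mxE.
  have /matrixP/(_ (p i) (p j)) := PP; rewrite !mxE (inj_eq perm_inj) => <-.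
  by apply: eq_bigr => k _; rewrite !mxE conjCK.
rewrite /eig_diag mul_mx_diag; apply/matrixP => i j; rewrite !mxE eigE.
have : M *m P^t* = P^t* *m diag_mx sp by rewrite {1}hPM -[LHS]mulmxA PP mulmx1.
rewrite mul_mx_diag => /matrixP/(_ i (p j)); rewrite !mxE => <-.
by apply: eq_bigr => k _; rewrite !mxE.
Qed.

Lemma unitary_of_ortho n (T : 'M[C]_n) : orthonormal_cols T -> T *m T^t* = 1%:M.
Proof. exact: mulmx1C. Qed.

Lemma ip_diag_left n k (d : 'I_n -> R) (Y : 'M[C]_(n, k)) :
  ip Y (diag_mx (\row_i (d i)%:C) *m Y) =
  \sum_j \sum_i d i * normc (Y i j) ^+ 2.
Proof.
rewrite ipE; apply: eq_bigr => j _; apply: eq_bigr => i _.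
by rewrite mul_diag_mx !mxE mulrCA ReZ Re_conjM.
Qed.

Lemma ip_diag_right n k (d : 'I_k -> R) (Y : 'M[C]_(n, k)) :
  ip Y (Y *m diag_mx (\row_i (d i)%:C)) =
  \sum_j \sum_i d j * normc (Y i j) ^+ 2.
Proof.
rewrite ipE; apply: eq_bigr => j _; apply: eq_bigr => i _.
by rewrite mul_mx_diag !mxE mulrA mulrC ReZ Re_conjM.
Qed.

Lemma ip_eig_diag_le n k (M : 'M[C]_n) (Y : 'M[C]_(k, 1)) : (k <= n)%N ->
  ip Y (eig_diag M k *m Y) <= eig M k * ip Y Y.
Proof.
move=> kn; rewrite ip_diag_left ip_sqE mulr_sumr ler_sum // => j _.
rewrite mulr_sumr ler_sum // => i _; rewrite ler_wpM2r ?sqr_ge0 // eig_le //.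
Qed.

Lemma ip_eigenbasis n k (M T : 'M[C]_n) (Y : 'M[C]_(n, k)) :
  smallest_eigvecs M T ->
  ip Y (M *m Y) = ip (T^t* *m Y) (eig_diag M n *m (T^t* *m Y)).
Proof.
move=> [hT hMT]; rewrite ip_mulmxl trmxCK !mulmxA -hMT -!mulmxA.
by rewrite [T *m _]mulmxA unitary_of_ortho // mul1mx.
Qed.

Lemma ip_eigenbasis_sq n k (T : 'M[C]_n) (Y : 'M[C]_(n, k)) :
  orthonormal_cols T -> ip (T^t* *m Y) (T^t* *m Y) = ip Y Y.
Proof.
by move=> hT; rewrite ip_isometry // /orthonormal_cols trmxCK unitary_of_ortho.
Qed.

Lemma ip_lambda_min n k (M : 'M[C]_n) (Y : 'M[C]_(n, k)) :
  M \is hermsymmx -> lambda_min M * ip Y Y <= ip Y (M *m Y).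
Proof.
move=> /hermitian_eigenbasis[T hT]; rewrite (ip_eigenbasis _ hT).
rewrite -(ip_eigenbasis_sq Y hT.1) ip_diag_left ip_sqE mulr_sumr ler_sum // => j _.
rewrite mulr_sumr ler_sum // => i _; rewrite ler_wpM2r ?sqr_ge0 // eig_le //.
Qed.

Lemma ip_lambda_max n k (M : 'M[C]_n) (Y : 'M[C]_(n, k)) :
  M \is hermsymmx -> ip Y (M *m Y) <= lambda_max M * ip Y Y.
Proof.
move=> /hermitian_eigenbasis[T hT]; rewrite (ip_eigenbasis _ hT).
rewrite -(ip_eigenbasis_sq Y hT.1) ip_diag_left ip_sqE mulr_sumr ler_sum // => j _.
rewrite mulr_sumr ler_sum // => i _; rewrite ler_wpM2r ?sqr_ge0 // eig_le //.
Qed.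

(* The test space meets the span of the eigenvectors number k, ..., n. *)
Lemma eig_le_test_space n k (M : 'M[C]_n) (X : 'M[C]_(n, k)) (c : R) :
  M \is hermsymmx -> (0 < k)%N -> (k <= n)%N -> orthonormal_cols X ->
  (forall a : 'cV[C]_k, ip (X *m a) (M *m (X *m a)) <= c * ip a a) ->
  eig M k <= c.
Proof.
move=> /hermitian_eigenbasis[T hT] k0 kn hX hc.
have kn' : (k.-1 <= n)%N by apply: leq_trans kn; exact: leq_pred.
(* [B] reads off the first [k - 1] eigencoordinates of [X a]; with fewer rows than columns it has a
   nonzero kernel vector. *)
pose B : 'M[C]_(k.-1, k) := \matrix_(i, j) (T^t* *m X) (widen_ord kn' i) j.
have [a a0 Ba] : exists2 a : 'cV[C]_k, a != 0 & B *m a = 0.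
  have : kermx B^T != 0.
    rewrite -mxrank_eq0 mxrank_ker subn_eq0 -ltnNge mxrank_tr.
    by rewrite (leq_ltn_trans (rank_leq_row _)) // prednK.
  rewrite -nz_row_eq0 => nz; exists (nz_row (kermx B^T))^T; first by rewrite trmx_eq0.
  apply: trmx_inj; rewrite trmx_mul trmxK trmx0; apply/sub_kermxP.
  exact: nz_row_sub.
have pa : 0 < ip a a.
  rewrite lt_def ip_ge0 andbT; apply/eqP => h; move/eqP: a0; apply.
  by apply: ip_eq0; rewrite h.
rewrite -(ler_pM2r pa); apply: le_trans (hc a).
rewrite (ip_eigenbasis _ hT) -(ip_isometry a a hX) -(ip_eigenbasis_sq (X *m a) hT.1).
rewrite ip_diag_left ip_sqE mulr_sumr ler_sum // => j _.
rewrite mulr_sumr ler_sum // => i _.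
case: (ltnP i k.-1) => ik; last first.
  by rewrite ler_wpM2r ?sqr_ge0 // eig_le // -(prednK k0) ltnS.
suff -> : (T^t* *m (X *m a)) i j = 0 by rewrite Normc.normc0 expr0n /= !mulr0.
move/matrixP: Ba => /(_ (Ordinal ik) j); rewrite mulmxA !mxE => Ba.
rewrite -[RHS]Ba; apply: eq_bigr => m _; congr (_ * _).
by rewrite [RHS]mxE; congr ((T^t* *m X) _ _); apply: val_inj.
Qed.

Lemma row_entry k (f : 'I_k -> C) j : (\row_i f i) 0 j = f j.
Proof. by rewrite mxE. Qed.

(** The columns of [X] need not be the first [k] columns of an eigenbasis [T], but the gap forces
    both to span the same space. Hence [Y] is orthogonal to the first [k] eigenvectors, and only
    eigenvalues from number [k + 1] on contribute. *)
Lemma ip_orthogonal_ge n k p (M : 'M[C]_n) (X : 'M[C]_(n, k)) (Y : 'M[C]_(n, p)) :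
  M \is hermsymmx -> (k < n)%N -> smallest_eigvecs M X ->
  eig M k < eig M k.+1 -> X^t* *m Y = 0 ->
  eig M k.+1 * ip Y Y <= ip Y (M *m Y).
Proof.
move=> hM kn [hX hMX] gap XY.
have [T hT] := hermitian_eigenbasis hM.
(* Evaluating [T^* M X] in two ways multiplies this entry by two eigenvalues, which differ because
   of the gap. Rows count from 0, so row [m] belongs to eigenvalue number [m + 1]. *)
have TX (m : 'I_n) (j : 'I_k) : (k <= m)%N -> (T^t* *m X) m j = 0.
  move=> km; have : T^t* *m X *m eig_diag M k = eig_diag M n *m (T^t* *m X).
    have /(congr1 (fun Z => Z^t* *m X)) := hT.2; rewrite !adjM (adj_herm hM).
    rewrite -!mulmxA hMX => ->; congr (_ *m _).
    rewrite /eig_diag tr_diag_mx map_diag_mx; congr diag_mx.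
    by apply/rowP => i; rewrite !mxE; apply: conjc_real.
  move/matrixP => /(_ m j); rewrite mul_mx_diag mul_diag_mx [LHS]mxE [RHS]mxE.
  rewrite !row_entry [LHS]mulrC => /eqP; rewrite -subr_eq0 -mulrBl mulf_eq0.
  case/orP => [|/eqP//]; rewrite subr_eq0 => /eqP/complexI h; exfalso.
  have h1 : eig M j.+1 <= eig M k by rewrite eig_le // ltnW.
  have h2 : eig M k.+1 <= eig M m.+1 by rewrite eig_le //.
  by move: gap; rewrite ltNge (le_trans h2) // -h.
have kn' := ltnW kn.
pose T1 : 'M[C]_(n, k) := \matrix_(i, j) T i (widen_ord kn' j).
have hT1 : orthonormal_cols T1.
  apply/matrixP => i j; have /matrixP/(_ (widen_ord kn' i) (widen_ord kn' j)) := hT.1.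
  rewrite !mxE => H; rewrite (_ : (i == j) = (widen_ord kn' i == widen_ord kn' j)) //.
  by rewrite -[RHS]H; apply: eq_bigr => m _; rewrite !mxE.
have X_T1 : X = T1 *m (T1^t* *m X).
  rewrite -[LHS]mul1mx -(unitary_of_ortho hT.1) -mulmxA.
  apply/matrixP => i j; rewrite [LHS]mxE [RHS]mxE.
  rewrite (bigID (fun m : 'I_n => (m < k)%N)) /= [X in _ + X]big1 ?addr0; last first.
    by move=> m; rewrite -leqNgt => /TX ->; rewrite mulr0.
  rewrite (big_ord_narrow kn') /=; apply: eq_bigr => m _; rewrite [T1 _ _]mxE.
  congr (_ * _); rewrite !mxE; apply: eq_bigr => s _; rewrite !mxE; congr (_ * _).
have T1Y : T1^t* *m Y = 0.
  set G := T1^t* *m X in X_T1.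
  (* [G] is square, so being an isometry makes it unitary and [G^*] can be cancelled. *)
  have GG : G^t* *m G = 1%:M.
    have -> : G^t* = X^t* *m T1 by rewrite /G adjM trmxCK.
    by rewrite -mulmxA -X_T1.
  have : G^t* *m (T1^t* *m Y) = 0 by rewrite mulmxA -adjM -X_T1.
  move/(congr1 (mulmx G)); rewrite mulmxA unitary_of_ortho //.
  by rewrite mul1mx mulmx0.
rewrite (ip_eigenbasis _ hT) -(ip_eigenbasis_sq Y hT.1).
rewrite ip_diag_left ip_sqE mulr_sumr ler_sum // => j _.
rewrite mulr_sumr ler_sum // => i _.
case: (leqP k i) => ik; first by rewrite ler_wpM2r ?sqr_ge0 // eig_le.
suff -> : (T^t* *m Y) i j = 0 by rewrite Normc.normc0 expr0n /= !mulr0.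
move/matrixP: T1Y => /(_ (Ordinal ik) j); rewrite !mxE => h; rewrite -[RHS]h.
by apply: eq_bigr => m _; rewrite !mxE; congr ((T _ _)^* * _)%R; apply: val_inj.
Qed.

End Spectrum.

(** * Perturbation of eigenvalues and Ritz spaces *)

Section Perturbation.
Local Open Scope sesquilinear_scope.
Local Open Scope complex_scope.
Context {R : realType}.
Local Notation C := (R[i]).
Local Notation normc := (@Normc.normc R).

Lemma conjM_normc (x : C) : ((x^*)%R * x)%R = (normc x ^+ 2)%:C.
Proof. by rewrite mulrC -normCK normr_normc rmorphXn. Qed.

(** For [M x = z x] the real part in [ip] turns [x^* M x] into [Re z] times the squared norm of [x],
    and [Re z] is [eig M k]. *)
Lemma eig_rayleigh n (M : 'M[C]_n) k : (0 < k)%N -> (k <= n)%N ->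
  exists2 x : 'cV[C]_n, 0 < ip x x & ip x (M *m x) = eig M k * ip x x.
Proof.
move=> k0 kn; have [z hz ->] := eig_root M k0 kn.
have [x x0 hx] := root_eigvec hz; exists x.
  rewrite lt_def ip_ge0 andbT; apply/eqP => h; move/eqP: x0; apply.
  by apply: ip_eq0; rewrite h.
rewrite hx ipE ip_sqE mulr_sumr; apply: eq_bigr => j _.
rewrite mulr_sumr; apply: eq_bigr => i _; rewrite mxE mulrCA.
by rewrite conjM_normc mulrC ReZ mulrC.
Qed.

Lemma adj_eig_diag n (M : 'M[C]_n) k : (eig_diag M k)^t* = eig_diag M k.
Proof.
rewrite /eig_diag tr_diag_mx map_diag_mx; congr diag_mx.
by apply/rowP => i; rewrite !mxE; apply: conjc_real.
Qed.

Lemma ip_scalar_col n (B : 'M[C]_n) (v : 'cV[C]_n) (a : 'M[C]_1) :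
  ip (v *m a) (B *m (v *m a)) = ip v (B *m v) * ip a a.
Proof.
rewrite [a]mx11_scalar mul_mx_scalar -scalemxAr (ip_sqE _%:M) !big_ord1 mxE eqxx mulr1n.
rewrite !ipE mulrC mulr_sumr; apply: eq_bigr => j _.
rewrite mulr_sumr; apply: eq_bigr => i _.
rewrite [(a 0 0 *: v) i j]mxE [(a 0 0 *: (_ *m _)) i j]mxE rmorphM /= mulrACA.
by rewrite conjM_normc ReZ.
Qed.

(** Scalar core of [lambda_min_perturb], where [t] and [s] are the norms of the parts of a vector
    along [v] and orthogonal to it. After the losses of size [e] at least [g / 2 * s ^+ 2] of the
    gap is left, and it absorbs the cross terms by completing a square. *)
Lemma quadratic_perturb (g e phi lam lam2 s t zE zEp zA : R) :
  0 < g -> 0 <= e -> 0 <= s -> 0 <= t -> e <= g / 4 ->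
  phi <= lam + e -> lam + g <= lam2 -> - (e * s ^+ 2) <= zE ->
  - (e * (s * t)) <= zEp -> lam2 * s ^+ 2 <= zA ->
  (phi - 2 / g * e ^+ 2) * (t ^+ 2 + s ^+ 2) <= phi * t ^+ 2 + (zEp + (zEp + (zA + zE))).
Proof.
move=> g0 e0 s0 t0 he hphi gap hzE hzEp hzA.
have key : 0 <= g / 2 * s ^+ 2 - 2 * (e * (s * t)) + 2 / g * e ^+ 2 * t ^+ 2.
  rewrite [leRHS](_ : _ = g / 2 * (s - 2 / g * e * t) ^+ 2); last first.
    by field; rewrite gt_eqF.
  by apply: mulr_ge0; [lra | exact: sqr_ge0].
have k2 : 0 <= 2 / g * e ^+ 2 * s ^+ 2.
  by rewrite !mulr_ge0 ?sqr_ge0 // invr_ge0 ltW.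
have s2 := sqr_ge0 s.
have k3 : (lam + g) * s ^+ 2 <= lam2 * s ^+ 2 by rewrite ler_wpM2r.
have k4 : phi * s ^+ 2 <= (lam + e) * s ^+ 2 by rewrite ler_wpM2r.
have k5 : e * s ^+ 2 <= g / 4 * s ^+ 2 by rewrite ler_wpM2r.
by lra.
Qed.

(** An eigenvector of [A1] is split into a part [p] along [v] and a part [z] orthogonal to it. The
    cross terms are of first order in [E]; weighed against the gap felt by [z], they cost only a
    second-order amount. *)
Lemma lambda_min_perturb n (A0 A1 : 'M[C]_n) (v : 'cV[C]_n) (g : R) :
  A0 \is hermsymmx -> A1 \is hermsymmx -> (1 < n)%N -> smallest_eigvecs A0 v ->
  0 < g -> lambda_min A0 + g <= eig A0 2 -> nrm (A1 - A0) <= g / 4 ->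
  ip v (A1 *m v) - 2 / g * nrm (A1 - A0) ^+ 2 <= lambda_min A1.
Proof.
move=> h0 h1 n1 hv g0 gap; set E := A1 - A0; set e := nrm E => he.
have A1E : A1 = A0 + E by rewrite /E addrCA subrr addr0.
have [x x0 hx] := @eig_rayleigh _ A1 1 isT (ltnW n1).
set phi := ip v _; set lam := lambda_min A0 in gap *.
have vv : ip v v = 1.
  by rewrite /ip hv.1 /mxtrace big_ord1 mxE eqxx.
have A0v : A0 *m v = lam%:C *: v.
  rewrite hv.2 /eig_diag mul_mx_diag; apply/matrixP => i j.
  by rewrite !mxE mulrC ord1.
pose a := v^t* *m x; pose p := v *m a; pose z := x - p.
have vz : v^t* *m z = 0 by rewrite /z /p mulmxBr mulmxA hv.1 mul1mx subrr.
have xpz : x = p + z by rewrite /z addrCA subrr addr0.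
have pz : ip p z = 0 by rewrite /p ip_mulmxl vz ip0r.
have A0p : A0 *m p = lam%:C *: p by rewrite /p mulmxA A0v scalemxAl.
have pBp : ip p (A1 *m p) = phi * ip p p.
  by rewrite /p ip_scalar_col ip_isometry //; exact: hv.1.
clearbody z p.
(* [A0 p] is a multiple of [p], hence orthogonal to [z]: only [E] couples the two parts. *)
have zBp : ip z (A1 *m p) = ip z (E *m p).
  by rewrite A1E mulmxDl ipDr A0p ipZr (ipC z p) pz mulr0 add0r.
have pBz : ip p (A1 *m z) = ip z (A1 *m p).
  by rewrite [RHS]ipC ip_mulmxl (adj_herm h1).
have phi_le : phi <= lam + e.
  rewrite /phi A1E mulmxDl ipDr A0v ipZr vv mulr1 lerD2l.
  have := ip_col_nrm v v E; rewrite -expr2 sqr_fnorm vv mulr1.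
  by apply: le_trans; exact: ler_norm.
have zE := ip_col_nrm z z E; have zEp := ip_col_nrm z p E.
have zA0 : eig A0 2 * ip z z <= ip z (A0 *m z).
  apply: (ip_orthogonal_ge h0 n1 hv) => //.
  by apply: lt_le_trans gap; rewrite ltrDl.
have zBz : ip z (A1 *m z) = ip z (A0 *m z) + ip z (E *m z).
  by rewrite {1}A1E mulmxDl ipDr.
rewrite -(ler_pM2r x0) -hx xpz mulmxDr !ipDl !ipDr pz (ipC z p) pz pBz zBp pBp zBz.
rewrite addr0 add0r -!sqr_fnorm -addrA.
apply: (quadratic_perturb g0 _ _ _ he phi_le gap).
- exact: nrm_ge0.
- exact: fnorm_ge0.
- exact: fnorm_ge0.
- by move: zE; rewrite ler_norml expr2 => /andP[].
- by move: zEp; rewrite ler_norml => /andP[].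
- by rewrite sqr_fnorm.
Qed.

(** Scalar core of [ritz_perturb]: [zA - zL] is at least [g / 2 * s ^+ 2] and equals [- zE], which
    is at most [e * c * s]. *)
Lemma gap_bound (g e c s a b zL zA zE : R) :
  0 < g -> 0 <= e -> 0 <= c -> 0 <= s -> e <= g / 2 -> a + g <= b ->
  zL <= (a + e) * s ^+ 2 -> b * s ^+ 2 <= zA -> - (e * c * s) <= zE ->
  0 = zE + zA - zL -> s <= c * 2 / g * e.
Proof.
move=> g0 e0 c0 s_ge0 he gap hL hA hE hQ; have s2 := sqr_ge0 s.
have k1 : (a + g) * s ^+ 2 <= b * s ^+ 2 by rewrite ler_wpM2r.
have k2 : e * s ^+ 2 <= g / 2 * s ^+ 2 by rewrite ler_wpM2r.
have k3 : g / 2 * s ^+ 2 <= e * c * s by lra.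
rewrite [leRHS](_ : _ = e * c / (g / 2)); last by field; rewrite gt_eqF.
rewrite ler_pdivlMr ?divr_gt0 // mulrC.
move: s_ge0; rewrite le_eqVlt => /predU1P[<-|s_gt0]; first by rewrite mulr0 mulr_ge0.
by rewrite -(ler_pM2r s_gt0) -mulrA -expr2.
Qed.

(** A bound of Davis-Kahan type. The residual [Q] is orthogonal to the range of [V], which contains
    the columns of [X] and of the deviation [Z]. Expanding [ip Z Q = 0] and using the gap gives the
    size of [Z]; the decomposition [QE] then gives that of [Q]. *)
Lemma ritz_perturb n d r (A0 : 'M[C]_n) (X : 'M[C]_(n, r)) (V : 'M[C]_(n, d)) (g : R) :
  A0 \is hermsymmx -> (0 < r)%N -> (r < n)%N -> (r <= d)%N ->
  smallest_eigvecs A0 X -> orthonormal_cols V -> V *m (V^t* *m X) = X ->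
  0 < g -> eig A0 r + g <= eig A0 r.+1 ->
  exists2 K : R, 0 <= K & forall (A1 : 'M[C]_n) (W : 'M[C]_(d, r)),
    A1 \is hermsymmx -> smallest_eigvecs (V^t* *m A1 *m V) W ->
    nrm (A1 - A0) <= g / 2 ->
    let U := V *m W in
    nrm (U - X *m (X^t* *m U)) <= K * nrm (A1 - A0) /\
    nrm (A1 *m U - U *m (U^t* *m A1 *m U)) <= K * nrm (A1 - A0).
Proof.
move=> h0 r0 rn rd hX hV VX g0 gap.
pose c : R := (n * r)%:R; have c0 : 0 <= c by rewrite ler0n.
(* [KZ] is the constant for the deviation [Z], and [KR] adds up the contributions of the terms of
   [QE] to the residual. *)
pose KZ := c * (c * 2 / g).
pose a := nrm A0; have a0 : 0 <= a by exact: nrm_ge0.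
have KZ0 : 0 <= KZ by rewrite !mulr_ge0 ?invr_ge0 // ltW.
pose KR := c + c * c * c + a * KZ + KZ * (c * (a + g) * c).
have KR0 : 0 <= KR.
  rewrite /KR; move: (KZ) KZ0 => K K0; move: (ltW g0) => g0'.
  by do ?[apply: addr_ge0 | apply: mulr_ge0].
exists (KZ + KR); first by rewrite addr_ge0.
move=> A1 W h1 hW; set E := A1 - A0; set e := nrm E => he U.
have e0 : 0 <= e by exact: nrm_ge0.
have A1E : A1 = A0 + E by rewrite /E addrCA subrr addr0.
rewrite -/e in he; clearbody E.
set L := eig_diag (V^t* *m A1 *m V) r in hW.
have hU : orthonormal_cols U.
  by rewrite /orthonormal_cols /U adjM -mulmxA [V^t* *m (V *m W)]mulmxA hV mul1mx hW.1.
have nU : nrm U <= c by exact: nrm_ortho.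
have nX : nrm X <= c by apply: nrm_ortho; exact: hX.1.
have nU' : nrm (U^t*) <= c by rewrite nrm_adj.
have nX' : nrm (X^t*) <= c by rewrite nrm_adj.
have UAU : U^t* *m A1 *m U = L.
  rewrite /U adjM -!mulmxA [V^t* *m _]mulmxA [_ *m (V *m W)]mulmxA hW.2 mulmxA.
  by rewrite hW.1 mul1mx.
rewrite UAU; pose Q := A1 *m U - U *m L; rewrite -/Q.
(* Galerkin orthogonality of the Ritz residual. *)
have VQ : V^t* *m Q = 0.
  by rewrite /Q mulmxBr /U !mulmxA hW.2 hV mul1mx subrr.
have XV : X^t* = X^t* *m V *m V^t* by rewrite -{1}VX !adjM trmxCK.
have XQ : X^t* *m Q = 0 by rewrite XV -mulmxA VQ mulmx0.
pose G := X^t* *m U; pose Z := U - X *m G; rewrite -/G -/Z.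
have XZ : X^t* *m Z = 0 by rewrite /Z mulmxBr [X^t* *m (X *m _)]mulmxA hX.1 mul1mx subrr.
have UXZ : U = X *m G + Z by rewrite /Z addrCA subrr addr0.
have ZX p (Y : 'M[C]_(r, p)) (Z' : 'M[C]_(n, p)) : X^t* *m Z' = 0 -> ip Z' (X *m Y) = 0.
  by move=> h; rewrite ipC ip_mulmxl h ip0r.
have ZQ : ip Z Q = 0.
  have -> : Z = V *m (W - V^t* *m X *m G) by rewrite mulmxBr -/U (mulmxA V) VX.
  by rewrite ip_mulmxl VQ ip0r.
have XA0 : X^t* *m A0 = eig_diag A0 r *m X^t*.
  have /(congr1 (fun Y => Y^t*)) := hX.2.
  by rewrite !adjM (adj_herm h0) adj_eig_diag.
(* Since [X^* Q = 0], the component along [X] is expressed through [E] alone and is therefore of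
   first order. *)
have XEU : eig_diag A0 r *m G - G *m L = - (X^t* *m (E *m U)).
  apply/eqP; rewrite -addr_eq0; apply/eqP; rewrite -[RHS]XQ /Q A1E mulmxDl.
  by rewrite mulmxBr mulmxDr [X^t* *m (A0 *m U)]mulmxA XA0 -!mulmxA addrAC.
clearbody Z G U.
have QE : Q = X *m (eig_diag A0 r *m G - G *m L) + E *m U + (A0 *m Z - Z *m L).
  have abel (s1 s2 s3 s4 s5 : 'M[C]_(n, r)) :
      s1 + s2 + s3 - (s4 + s5) = s1 - s4 + s3 + (s2 - s5).
    by rewrite opprD !addrA [s1 - s4 + s3]addrAC [_ - s4 + s2]addrAC [s1 + s2 + s3]addrAC.
  rewrite mulmxBr !mulmxA -hX.2 -[A0 *m X *m G]mulmxA -abel.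
  by rewrite -mulmxDr -UXZ -mulmxDl -mulmxDl -UXZ -A1E.
have weyl : eig (V^t* *m A1 *m V) r <= eig A0 r + e.
  apply: (@eig_le_test_space _ _ _ _ (V^t* *m X)) => //.
  - exact: herm_congr.
  - by rewrite /orthonormal_cols adjM trmxCK -mulmxA VX hX.1.
  - move=> b; have VXb : V *m (V^t* *m X *m b) = X *m b by rewrite mulmxA VX.
    move: (V^t* *m X *m b) VXb => w VXb.
    rewrite -!mulmxA -ip_mulmxl VXb A1E mulmxDl ipDr.
    rewrite [A0 *m _]mulmxA hX.2 -mulmxA ip_isometry; last exact: hX.1.
    rewrite mulrDl lerD // ?ip_eig_diag_le // 1?ltnW //.
    apply: le_trans (ler_norm _) _; apply: le_trans (ip_col_nrm _ _ _) _.
    by rewrite -expr2 sqr_fnorm ip_isometry //; exact: hX.1.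
have ZL : ip Z (Z *m L) <= (eig A0 r + e) * ip Z Z.
  rewrite ip_diag_right ip_sqE mulr_sumr ler_sum // => j _.
  rewrite mulr_sumr ler_sum // => i _; rewrite ler_wpM2r ?sqr_ge0 //.
  by apply: le_trans weyl; rewrite eig_le.
have ZA0 : eig A0 r.+1 * ip Z Z <= ip Z (A0 *m Z).
  by apply: ip_orthogonal_ge hX _ XZ => //; apply: lt_le_trans gap; rewrite ltrDl.
have ZE : `|ip Z (E *m U)| <= e * c * fnorm Z.
  rewrite ipC; apply: le_trans (ip_nrm _ _) _; rewrite ler_wpM2r ?fnorm_ge0 //.
  by apply: le_trans (nrmM _ _) _; rewrite ler_wpM2l.
have ZQE : ip Z Q = ip Z (E *m U) + ip Z (A0 *m Z) - ip Z (Z *m L).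
  by rewrite QE !ipDr ZX // add0r ipNr addrA.
have sZ : fnorm Z <= c * 2 / g * e.
  move: ZL ZA0 ZE ZQE; rewrite ZQ -sqr_fnorm ler_norml => ZL ZA0 /andP[ZE _] ZQE.
  by apply: (gap_bound g0 e0 c0 _ he gap ZL ZA0 ZE ZQE); exact: fnorm_ge0.
have nZ : nrm Z <= KZ * e.
  by apply: le_trans (nrm_fnorm _) _; rewrite /KZ -mulrA ler_wpM2l.
have nL : nrm L <= c * (a + g) * c.
  rewrite -UAU; apply: le_trans (nrmM _ _) _; apply: ler_pM; rewrite ?nrm_ge0 //.
  apply: le_trans (nrmM _ _) _; apply: ler_pM; rewrite ?nrm_ge0 //.
  rewrite A1E; apply: le_trans (nrmD _ _) _; rewrite lerD2l (le_trans he) //.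
  by rewrite ler_pdivrMr // ler_pMr // ler1n.
have nEU : nrm (E *m U) <= e * c by apply: le_trans (nrmM _ _) _; rewrite ler_wpM2l.
split; first by apply: le_trans nZ _; rewrite ler_wpM2r // lerDl.
apply: (@le_trans _ _ (KR * e)); last by rewrite ler_wpM2r // lerDr.
rewrite QE XEU; apply: le_trans (nrmD _ _) _.
have -> : KR * e = (c * (c * (e * c)) + e * c) + (a * (KZ * e) + (KZ * e) * (c * (a + g) * c)).
  by rewrite /KR; ring.
apply: lerD.
  apply: le_trans (nrmD _ _) _; apply: lerD => //.
  apply: le_trans (nrmM _ _) _; apply: ler_pM; rewrite ?nrm_ge0 // nrmN.
  by apply: le_trans (nrmM _ _) _; apply: ler_pM; rewrite ?nrm_ge0.
apply: le_trans (nrmB _ _) _; apply: lerD.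
  by apply: le_trans (nrmM _ _) _; rewrite ler_wpM2l.
by apply: le_trans (nrmM _ _) _; apply: ler_pM; rewrite ?nrm_ge0.
Qed.

End Perturbation.

(** * Residual and modified eigenvalue gaps *)

Section RitzQuantities.
Local Open Scope sesquilinear_scope.
Local Open Scope complex_scope.
Context {R : realType}.
Local Notation C := (R[i]).
Local Notation Re := (@complex.Re R).
Local Notation normc := (@Normc.normc R).

Lemma ortho_submx n r s (U : 'M[C]_(n, r)) (U' : 'M[C]_(n, s)) :
  orthonormal_cols U -> orthonormal_cols U' -> (U^T <= U'^T)%MS ->
  exists2 G : 'M[C]_(s, r), U = U' *m G & orthonormal_cols G.
Proof.
move=> hU hU' /submxP[H UH]; exists H^T.
  by apply: trmx_inj; rewrite trmx_mul trmxK.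
have UE : U = U' *m H^T by apply: trmx_inj; rewrite trmx_mul trmxK.
by rewrite /orthonormal_cols -hU [in RHS]UE adjM -mulmxA [U'^t* *m _]mulmxA hU' mul1mx.
Qed.

Lemma pid_mx_ortho l r : (r <= l)%N -> orthonormal_cols (pid_mx r : 'M[C]_(l, r)).
Proof.
move=> rl; rewrite /orthonormal_cols tr_pid_mx map_pid_mx mul_pid_mx minnn.
by rewrite (minn_idPr rl) pid_mx_1.
Qed.

(* Cyclicity of the trace. *)
Lemma ip_adj_defect r (K : 'M[C]_r) :
  ip (K *m K^t* - 1%:M) (K *m K^t* - 1%:M) = ip (K^t* *m K - 1%:M) (K^t* *m K - 1%:M).
Proof.
have h1 : ip (K *m K^t*) (K *m K^t*) = ip (K^t* *m K) (K^t* *m K).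
  by rewrite ip_mulmxl [RHS]ip_mulmxr mulmxA.
have h2 : ip (K *m K^t*) 1%:M = ip (K^t* *m K) 1%:M.
  by rewrite ip_mulmxl [RHS]ip_mulmxr mulmx1 mul1mx.
by rewrite !ipBl !ipBr h1 ![ip 1%:M (_ *m _)]ipC h2.
Qed.

(** In the coordinates of [Vi], [U] becomes [J G] plus a term of order [z]. Since
    [G^* G = 1 - Z^* Z], [G] is nearly unitary, so the compressed projector is close to [J J^*],
    which is [pid_mx r]. *)
Lemma coord_perturb n l r (Vi : 'M[C]_(n, l)) :
  orthonormal_cols Vi -> (r <= l)%N ->
  exists2 K : R, 0 <= K & forall U : 'M[C]_(n, r), orthonormal_cols U ->
    let X := Vi *m (pid_mx r : 'M[C]_(l, r)) in
    let z := nrm (U - X *m (X^t* *m U)) in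
    z <= 1 -> nrm (Vi^t* *m U *m U^t* *m Vi - pid_mx r) <= K * z.
Proof.
move=> hV rl; pose J : 'M[C]_(l, r) := pid_mx r.
have hJ : orthonormal_cols J by exact: pid_mx_ortho.
have hX : orthonormal_cols (Vi *m J).
  by rewrite /orthonormal_cols adjM -mulmxA [Vi^t* *m _]mulmxA hV mul1mx.
pose c : R := (n * r)%:R; pose j : R := (l * r)%:R; pose v : R := (n * l)%:R.
have [c0 j0 v0] : [/\ 0 <= c, 0 <= j & 0 <= v] by rewrite !ler0n.
pose k := (r * r)%:R : R; have k0 : 0 <= k by rewrite ler0n.
exists (j * k * j + j * (c * c) * v + v * (c * c) * j + v * v).
  by rewrite ?addr_ge0 ?mulr_ge0.
move=> U hU X z; set Z := U - _ in z *; move=> z1; pose G := X^t* *m U.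
have z0 : 0 <= z by exact: nrm_ge0.
have nX : nrm X <= c by exact: nrm_ortho.
have nU : nrm U <= c by exact: nrm_ortho.
have nJ : nrm J <= j by exact: nrm_ortho.
have nV : nrm Vi <= v by exact: nrm_ortho.
have nG : nrm G <= c * c.
  by apply: le_trans (nrmM _ _) _; rewrite nrm_adj ler_pM ?nrm_ge0.
have XX : X^t* *m X = 1%:M by exact: hX.
have ZZ : Z^t* *m Z = 1%:M - G^t* *m G.
  rewrite /Z -/G adjB adjM mulmxBl !mulmxBr -[_ *m X^t* *m (X *m G)]mulmxA.
  rewrite [X^t* *m (X *m G)]mulmxA XX mul1mx hU.
  rewrite -[G^t* *m X^t* *m U]mulmxA -/G [U^t* *m (X *m G)]mulmxA.
  have -> : U^t* *m X = G^t* by rewrite /G adjM trmxCK.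
  by rewrite subrr subr0.
(* [ZZ] controls [G^* G], while the expansion contains [G G^*]; for square [G] both defects have the
   same Frobenius norm. The resulting [z ^+ 2] is at most [z] because [z <= 1]. *)
have nGG : nrm (G *m G^t* - 1%:M) <= k * z.
  apply: le_trans (nrm_fnorm _) _; rewrite ler_wpM2l //.
  rewrite /fnorm ip_adj_defect -/(fnorm _).
  apply: (@le_trans _ _ (nrm (G^t* *m G - 1%:M))).
    rewrite -(@ler_pXn2r _ 2) ?nnegrE ?fnorm_ge0 ?nrm_ge0 // sqr_fnorm.
    exact: ip_le_nrm2.
  rewrite -nrmN opprB -ZZ; apply: le_trans (nrmM _ _) _.
  by rewrite nrm_adj -/z ler_piMl.
have VU : Vi^t* *m U = J *m G + Vi^t* *m Z.
  rewrite /Z -/G mulmxBr /X [Vi^t* *m (_ *m G)]mulmxA [Vi^t* *m (Vi *m _)]mulmxA hV.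
  by rewrite mul1mx addrCA subrr addr0.
set F := Vi^t* *m Z in VU.
have nF : nrm F <= v * z by apply: le_trans (nrmM _ _) _; rewrite nrm_adj ler_wpM2r.
have UV : U^t* *m Vi = G^t* *m J^t* + F^t*.
  by rewrite -[LHS]trmxCK adjM trmxCK VU adjD adjM.
have JJ : pid_mx r = J *m J^t*.
  by rewrite /J tr_pid_mx map_pid_mx mul_pid_mx minnn (minn_idPr (leqnn _)).
clearbody F G Z.
have -> : Vi^t* *m U *m U^t* *m Vi - pid_mx r =
    J *m (G *m G^t* - 1%:M) *m J^t* + J *m G *m F^t* + F *m (G^t* *m J^t*) + F *m F^t*.
  have abel (s1 s2 s3 s4 s5 : 'M[C]_l) :
      s1 + s2 + (s3 + s4) - s5 = s1 - s5 + s3 + s2 + s4.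
    by rewrite !addrA [s1 - s5 + s3]addrAC [_ - s5 + s2]addrAC [_ - s5 + s4]addrAC
      [s1 + s2 + s3]addrAC.
  rewrite -mulmxA UV VU JJ mulmxDr !mulmxDl abel mulmxBr mulmxBl mulmx1.
  by rewrite !mulmxA.
rewrite !mulrDl; apply: le_trans (nrmD _ _) _; apply: lerD; last first.
  apply: le_trans (nrmM _ _) _; rewrite nrm_adj.
  apply: (@le_trans _ _ ((v * z) * (v * z))); first by rewrite ler_pM ?nrm_ge0.
  by rewrite mulrACA ler_wpM2l ?mulr_ge0 // ler_piMr.
apply: le_trans (nrmD _ _) _; apply: lerD; last first.
  have -> : v * (c * c) * j * z = v * z * (c * c * j) by ring.
  apply: le_trans (nrmM _ _) _; rewrite ler_pM ?nrm_ge0 //.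
  by apply: le_trans (nrmM _ _) _; rewrite !nrm_adj ler_pM ?nrm_ge0.
apply: le_trans (nrmD _ _) _; apply: lerD.
  apply: le_trans (nrmM _ _) _; rewrite nrm_adj mulrAC ler_pM ?nrm_ge0 //.
  by apply: le_trans (nrmM _ _) _; rewrite -mulrA ler_pM ?nrm_ge0.
apply: le_trans (nrmM _ _) _; rewrite nrm_adj -[leRHS]mulrA ler_pM ?nrm_ge0 //.
by apply: le_trans (nrmM _ _) _; rewrite ler_pM ?nrm_ge0.
Qed.

Lemma spectral_norm_sq m n (M : 'M[C]_(m, n)) : (0 < n)%N ->
  spectral_norm M ^+ 2 <= nrm M ^+ 2.
Proof.
move=> n0; apply: (@le_trans _ _ (nrm (M^t* *m M))); last first.
  by apply: le_trans (nrmM _ _) _; rewrite nrm_adj expr2.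
rewrite /spectral_norm; have := @eig_nrm _ _ (M^t* *m M) n n0 (leqnn n).
(* [Num.sqrt] vanishes on negative reals, so this case split stands in for positive semidefiniteness
   of [M^* M]. *)
rewrite -/(lambda_max _); case: (leP 0 (lambda_max (M^t* *m M))) => h.
  by rewrite sqr_sqrtr // ger0_norm.
by rewrite ltr0_sqrtr // expr0n /= => _; exact: nrm_ge0.
Qed.

Lemma residual_basis n r (B : 'M[C]_n) (U : 'M[C]_(n, r)) (G : 'M[C]_r) :
  orthonormal_cols G ->
  B *m (U *m G) - (U *m G) *m ((U *m G)^t* *m B *m (U *m G)) =
  (B *m U - U *m (U^t* *m B *m U)) *m G.
Proof.
move=> /unitary_of_ortho GG; rewrite adjM mulmxBl !mulmxA; congr (_ - _).
by rewrite -[U *m G *m G^t*]mulmxA GG mulmx1.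
Qed.

(** With [pid_mx r] in place of [M] the matrix is diagonal: the first [r] entries are
    [eig M0 l.+1 - lambda_min M0], the others [eig M0 k.+1 - lambda_min M0] with [r <= k]. All are
    at least [g], and Gershgorin accounts for the remaining term. *)
Lemma beta_diag_lower n l r (M0 : 'M[C]_n) (M S : 'M[C]_l) (g : R) :
  (0 < r)%N -> (r <= l)%N -> (l < n)%N -> g <= eig M0 r.+1 - eig M0 r ->
  S = eig_diag M0 l - (eig M0 l.+1)%:C%:M ->
  g - nrm (M - pid_mx r) * nrm S <=
    lambda_min (eig_diag M0 l - (lambda_min M0)%:C%:M - M *m S).
Proof.
move=> r0 rl ln gap SE; have l0 : (0 < l)%N by exact: leq_trans r0 rl.
pose D := eig_diag M0 l - (lambda_min M0)%:C%:M - pid_mx r *m S.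
have -> : eig_diag M0 l - (lambda_min M0)%:C%:M - M *m S = D + (pid_mx r - M) *m S.
  by rewrite /D mulmxBl addrA subrK.
rewrite /lambda_min; set B := D + _.
have [z hz ->] := @eig_root _ _ B 1 isT l0.
have subE i j (c : R) : (eig_diag M0 l - c%:C%:M) i j =
    (eig M0 i.+1)%:C *+ (i == j) - c%:C *+ (i == j) by rewrite !mxE.
have pidE (i j : 'I_l) : (pid_mx r *m S) i j =
    (if (i < r)%N then (eig M0 i.+1 - eig M0 l.+1)%:C else 0) *+ (i == j).
  rewrite mxE (bigD1 i) //= big1 ?addr0 => [|k ki]; last first.
    by rewrite mxE (_ : (i == k :> nat) = false) ?mul0r // val_eqE eq_sym (negbTE ki).
  rewrite mxE eqxx /= SE subE -mulrnBl -rmorphB mulrnAr.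
  by case: (i < r)%N; rewrite ?mul1r ?mul0r.
have DE i j : D i j = (eig M0 i.+1 - lambda_min M0 -
    (if (i < r)%N then eig M0 i.+1 - eig M0 l.+1 else 0))%:C *+ (i == j).
  rewrite /D [LHS]mxE [(- (_ *m S)) i j]mxE pidE subE.
  by rewrite -!mulrnBl !rmorphB; case: (i < r)%N; rewrite ?rmorphB ?rmorph0.
have [i j ij|k] := @root_char_poly_near_diag _ _ _ _ _ _ hz; first by rewrite DE (negbTE ij).
rewrite DE eqxx mulr1n => hk.
have nE : nrm ((pid_mx r - M) *m S) <= nrm (M - pid_mx r) * nrm S.
  by apply: le_trans (nrmM _ _) _; rewrite -nrmN opprB.
have := le_trans (le_Re_normc _) (le_trans hk nE); rewrite ReD ReN.
rewrite [Re _%:C]/= ler_norml => /andP[h _].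
set q := _ - (if _ then _ else _) in h.
suff : g <= q by lra.
have m0 : lambda_min M0 <= eig M0 r by apply: eig_le => //; apply: ltnW; exact: leq_ltn_trans ln.
have kl := ltn_ord k.
rewrite /q; case: ltnP => kr.
  have : eig M0 r.+1 <= eig M0 l.+1 by apply: eig_le.
  by lra.
have : eig M0 r.+1 <= eig M0 k.+1 by apply: eig_le => //; exact: ltn_trans kl ln.
by lra.
Qed.

End RitzQuantities.

(** * The linear program *)

Section LinearProgram.
Local Open Scope sesquilinear_scope.
Local Open Scope complex_scope.
Context {R : realType} {P Q N J : nat}.
Local Notation C := (R[i]).
Variables (A : 'I_Q -> 'M[C]_N) (theta : 'I_Q -> 'rV[R]_P -> R).
Variable mus : 'I_J -> 'rV[R]_P.
Local Notation Amu := (Amu A theta).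
Local Notation theta_row := (theta_row theta).
Implicit Types (act : 'I_Q -> @constr Q J) (y : 'cV[R]_Q).

(** The bound is the reciprocal of 1 plus the sum of the reciprocals; the summand 1 covers an empty
    [T]. *)
Lemma fin_pos_lower (T : finType) (F : T -> R) :
  (forall a, 0 < F a) -> exists2 t : R, 0 < t & forall a, t <= F a.
Proof.
move=> F0; pose s := 1 + \sum_a (F a)^-1; have s0 : 0 < s.
  by rewrite ltr_pwDl // sumr_ge0 // => a _; rewrite invr_ge0 ltW.
exists s^-1; rewrite ?invr_gt0 // => a; rewrite -[leRHS]invrK lef_pV2 ?posrE ?invr_gt0 //.
rewrite /s (bigD1 a) //= addrCA lerDl addr_ge0 // sumr_ge0 // => b _.
by rewrite invr_ge0 ltW.
Qed.

Definition constr_rhs_col act : 'cV[R]_Q :=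
  \col_k constr_rhs A theta mus (act k).

(** Nondegeneracy is stated for the canonical enumeration of the active set. Its rows all occur in
    [Theta], so full rank carries over to any other enumeration. *)
Lemma Theta_unit y act :
  simple_nondegenerate A theta mus -> is_vertex (Y_LB A theta mus) y ->
  active_enum A theta mus y act -> Theta theta mus act \in unitmx.
Proof.
move=> hs hy [_ hact]; have [cardQ free] := hs _ hy.
rewrite -row_full_unit /row_full eqn_leq rank_leq_col /= -[X in (X <= _)%N]cardQ.
rewrite -(eqP free); apply: mxrankS; apply/row_subP => k.
have /codomP[m hm] : enum_val k \in codom act by rewrite -hact enum_valP.
by rewrite rowK hm -(rowK (fun m => constr_row theta mus (act m))) row_sub.
Qed.

(** A vertex is thus determined by its active constraints, which leaves finitely many candidates. *)
Lemma Theta_solution y act : Theta theta mus act \in unitmx ->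
  active_enum A theta mus y act -> y = invmx (Theta theta mus act) *m constr_rhs_col act.
Proof.
move=> hu [_ hact]; suff <- : Theta theta mus act *m y = constr_rhs_col act by rewrite mulKmx.
apply/matrixP => k j; rewrite ord1 [RHS]mxE.
have : act k \in active A theta mus y by rewrite hact codom_f.
rewrite inE => /eqP <-; rewrite [LHS]mxE [RHS]mxE; apply: eq_bigr => q _.
by rewrite [X in X * _ = _]mxE.
Qed.

Lemma theta_row_dot mu y : (theta_row mu *m y) 0 0 = \sum_q theta q mu * y q 0.
Proof. by rewrite mxE; apply: eq_bigr => q _; rewrite mxE. Qed.

(** For a unit vector [v], a point of the joint numerical range of the matrices [A q]; the LP
    objective at this point is a Rayleigh quotient of [A(mu)]. *)
Definition rayleigh_point (v : 'cV[C]_N) : 'cV[R]_Q := \col_q ip v (A q *m v).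

Lemma theta_rayleigh mu v : (theta_row mu *m rayleigh_point v) 0 0 = ip v (Amu mu *m v).
Proof.
rewrite theta_row_dot /Defs.Amu mulmx_suml (big_morph (ip v) (ipDr v) (ip0r v)).
by apply: eq_bigr => q _; rewrite mxE -scalemxAl ipZr.
Qed.

Lemma Amu_herm mu : (forall q, A q \is hermsymmx) -> Amu mu \is hermsymmx.
Proof.
move=> hA; rewrite hermsymmxE /Defs.Amu linear_sum /= raddf_sum; apply/eqP.
apply: eq_bigr => q _; rewrite linearZ /= map_mxZ /= (adj_herm (hA q)).
by congr (_ *: _); apply: conjc_real.
Qed.

Lemma rayleigh_point_feasible v :
  (forall q, A q \is hermsymmx) -> ip v v = 1 -> Y_LB A theta mus (rayleigh_point v).
Proof.
move=> hA v1; split=> [q|j].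
  have := ip_lambda_min v (hA q); have := ip_lambda_max v (hA q).
  by rewrite v1 !mulr1 mxE => -> ->.
by rewrite theta_rayleigh; have := ip_lambda_min v (Amu_herm (mus j) hA); rewrite v1 mulr1.
Qed.

(** All local estimates are measured in this distance of coefficient vectors, so the
    differentiability of [theta] enters only in the final transfer. *)
Definition theta_dist (mu nu : 'rV[R]_P) : R := \sum_q `|theta q mu - theta q nu|.

Lemma theta_dist_ge0 mu nu : 0 <= theta_dist mu nu.
Proof. by apply: sumr_ge0. Qed.

Lemma theta_row_dist mu nu y :
  `|(theta_row mu *m y) 0 0 - (theta_row nu *m y) 0 0| <= theta_dist mu nu * \sum_q `|y q 0|.
Proof.
rewrite !theta_row_dot -sumrB /theta_dist mulr_suml; apply: le_trans (ler_norm_sum _ _ _) _.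
apply: ler_sum => q _; rewrite -mulrBl normrM ler_wpM2l //.
by rewrite (bigD1 q) //= lerDl sumr_ge0.
Qed.

(* There are finitely many sets of active constraints; a vertex at which the
   i-th sample constraint is slack is not optimal for [theta mu] near
   [theta (mus i)], since some feasible point makes that constraint tight. *)
Lemma sample_constraint_active (D : set 'rV[R]_P) (y : 'rV[R]_P -> 'cV[R]_Q)
    (act : 'rV[R]_P -> 'I_Q -> @constr Q J) (i : 'I_J) (ystar : 'cV[R]_Q) :
  simple_nondegenerate A theta mus ->
  (forall mu, D mu -> LP_vertex A theta mus mu (y mu)) ->
  (forall mu, D mu -> active_enum A theta mus (y mu) (act mu)) ->
  Y_LB A theta mus ystar ->
  (theta_row (mus i) *m ystar) 0 0 = lambda_min (Amu (mus i)) ->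
  exists2 t : R, 0 < t & forall mu, D mu -> theta_dist mu (mus i) < t ->
    exists k, act mu k = inr i.
Proof.
move=> hs hLP hact hstar tight.
pose ya (a : {ffun 'I_Q -> @constr Q J}) := invmx (Theta theta mus a) *m constr_rhs_col a.
pose w a := ya a - ystar.
pose F a := (theta_row (mus i) *m w a) 0 0.
pose S a := 1 + \sum_q `|w a q 0|.
have S0 a : 0 < S a by rewrite ltr_pwDl // sumr_ge0.
(* A candidate vertex with positive excess [F a] over [ystar] loses to it while the distance is
   below [F a / S a]; the other candidates impose no restriction. *)
pose t a := if 0 < F a then F a / S a else 1.
have [|t0 t0_gt0 ht0] := @fin_pos_lower _ t.
  by move=> a; rewrite /t; case: ifP => // h; rewrite divr_gt0.
exists t0 => // mu Dmu hmu; pose a := [ffun k => act mu k].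
have aE : (a : 'I_Q -> constr) = act mu by apply/funext => k; rewrite ffunE.
have [vtx opt] := hLP _ Dmu.
have yE : y mu = ya a.
  by rewrite /ya aE; apply: Theta_solution (hact _ Dmu); apply: Theta_unit (hact _ Dmu).
have Fle : F a <= theta_dist mu (mus i) * \sum_q `|w a q 0|.
  have := theta_row_dist mu (mus i) (w a); rewrite ler_norml => /andP[h _].
  have : (theta_row mu *m w a) 0 0 <= 0.
    by rewrite /w -yE mulmxBr mxE [(- _ : 'M[R]_1) 0 0]mxE subr_le0 opt.
  by move: h; rewrite -/(F a); lra.
have F0 : F a <= 0.
  rewrite leNgt; apply/negP => Fa; have := ht0 a; rewrite /t Fa => ht.
  have := lt_le_trans hmu ht; rewrite ltr_pdivlMr // ltNge => /negP; apply.
  apply: le_trans Fle _; rewrite ler_wpM2l ?theta_dist_ge0 //.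
  by rewrite /S lerDr.
have : inr i \in active A theta mus (y mu).
  rewrite inE /= eq_le; apply/andP; split; last exact: vtx.1.2.
  by move: F0; rewrite /F /w -yE mulmxBr mxE [(- _ : 'M[R]_1) 0 0]mxE tight subr_le0.
by rewrite (hact _ Dmu).2 => /codomP[k hk]; exists k.
Qed.

End LinearProgram.

(** * Ingredients of the local estimate *)

Section LocalBound.
Local Open Scope sesquilinear_scope.
Local Open Scope complex_scope.
Context {R : realType}.
Local Notation C := (R[i]).

(** The characteristic polynomial splits over the listed eigenvalues, so the multiplicity counts
    indices; equality of the first two would give two of them. *)
Lemma simple_eigenvalue_gap n (M : 'M[C]_n) : M \is hermsymmx -> (1 < n)%N ->
  simple_eigenvalue M (lambda_min M) -> lambda_min M < eig M 2.
Proof.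
move=> hM n1 hs; rewrite lt_neqAle eig_le // andbT; apply/eqP => h12.
have [T [hT hMT]] := hermitian_eigenbasis hM.
have cp : char_poly M =
    \prod_(z <- [seq (eig M k.+1)%:C | k : 'I_n <- enum 'I_n]) ('X - z%:P).
  rewrite (@char_poly_similar _ _ (T^t*) M (eig_diag M n)).
  - rewrite char_poly_trig ?diag_mx_is_trig // big_map big_enum /=.
    by apply: eq_bigr => i _; rewrite !mxE eqxx.
  - by apply: (proj1 (mulmx1_unit _)); exact: hT.
  - by rewrite -[LHS]mulmx1 -(unitary_of_ortho hT) mulmxA -[_ *m M *m T]mulmxA hMT
      [T^t* *m (T *m _)]mulmxA hT mul1mx.
move: hs; rewrite /simple_eigenvalue cp mu_prod_XsubC count_map => hs.
have hc : #|[pred k : 'I_n | (eig M k.+1)%:C == (lambda_min M)%:C]| = 1%N.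
  by rewrite -hs enumT cardE /enum_mem size_filter; apply: eq_count.
pose i0 := Ordinal (ltnW n1); pose i1 := Ordinal n1.
have : ([set i0; i1] \subset [pred k : 'I_n | (eig M k.+1)%:C == (lambda_min M)%:C])%SET.
  apply/fintype.subsetP => k; rewrite !inE => /orP[]/eqP->; first exact: eqxx.
  by rewrite h12.
by move/subset_leq_card; rewrite cards2 hc.
Qed.

Lemma smallest_eigvecs_sub n l r (M : 'M[C]_n) (W : 'M[C]_(n, l)) : (r <= l)%N ->
  smallest_eigvecs M W -> smallest_eigvecs M (W *m (pid_mx r : 'M[C]_(l, r))).
Proof.
move=> rl [hW hMW]; split.
  rewrite /orthonormal_cols adjM -mulmxA [W^t* *m _]mulmxA hW mul1mx.
  exact: pid_mx_ortho.
rewrite mulmxA hMW -!mulmxA; congr (_ *m _).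
rewrite /eig_diag mul_diag_mx mul_mx_diag; apply/matrixP => i j; rewrite !mxE.
by case: eqP => [->|_]; rewrite /= ?mulr0 ?mul0r // mulrC.
Qed.

(** The separation makes [lV] the minimum and the denominator at least [dl]. *)
Lemma slb_scalar (lV e p dl : R) : 0 < dl -> lV + dl <= e ->
  lV - 2 / dl * p ^+ 2 <=
    Num.min lV e - 2 * p ^+ 2 / (`|lV - e| + Num.sqrt (`|lV - e| ^+ 2 + 4 * p ^+ 2)) <= lV.
Proof.
move=> dl0 h; rewrite min_l; last by lra.
have den : dl <= `|lV - e| + Num.sqrt (`|lV - e| ^+ 2 + 4 * p ^+ 2).
  apply: (@le_trans _ _ `|lV - e|); last by rewrite lerDl sqrtr_ge0.
  by rewrite distrC; apply: le_trans (ler_norm _); lra.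
have den0 := lt_le_trans dl0 den; have p2 := sqr_ge0 p.
apply/andP; split; last by rewrite gerBl; apply: divr_ge0; [exact: mulr_ge0 | exact: ltW].
rewrite lerD2l lerN2 ler_pdivrMr // [2 / dl * _]mulrAC [leRHS]mulrAC ler_pdivlMr //.
by rewrite ler_wpM2l // mulr_ge0.
Qed.

Context {P Q N J : nat}.
Variables (A : 'I_Q -> 'M[C]_N) (theta : 'I_Q -> 'rV[R]_P -> R).
Variable mus : 'I_J -> 'rV[R]_P.
Local Notation Amu := (Amu A theta).
Local Notation theta_row := (theta_row theta).
Local Notation theta_dist := (theta_dist theta).

(** Row [k] of [Theta] is [theta_row (mus i)], so replacing [mu] by [mus i] in [eta] yields exactly
    entry [k] of [psi_tilde]. *)
Lemma eta_estimate l r (vs : 'I_J -> 'M[C]_(N, l)) (U : 'M[C]_(N, r))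
    (act : 'I_Q -> @constr Q J) mu i k :
  Theta theta mus act \in unitmx -> act k = inr i ->
  `|Defs.eta A theta mus vs U act mu - (lambda_min (Amu (mus i)) + Defs.beta A theta mus vs U i)| <=
  theta_dist mu (mus i) *
    \sum_q `|(invmx (Theta theta mus act) *m psi_tilde A theta mus vs U act) q 0|.
Proof.
move=> hu hk; rewrite /Defs.eta -mulmxA; set z := _ *m psi_tilde _ _ _ _ _ _.
suff <- : (theta_row (mus i) *m z) 0 0 =
    lambda_min (Amu (mus i)) + Defs.beta A theta mus vs U i by exact: theta_row_dist.
have -> : theta_row (mus i) = row k (Theta theta mus act).
  by rewrite rowK hk.
by rewrite -row_mul /z mulKVmx // !mxE hk.
Qed.

Lemma sum_mulmx_le n (M : 'M[R]_n) (x : 'cV[R]_n) (B : R) : (forall k, `|x k 0| <= B) ->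
  \sum_q `|(M *m x) q 0| <= (\sum_q \sum_k `|M q k|) * B.
Proof.
move=> hB; rewrite mulr_suml ler_sum // => q _; rewrite mxE mulr_suml.
apply: le_trans (ler_norm_sum _ _ _) _; apply: ler_sum => k _.
by rewrite normrM ler_wpM2l.
Qed.

(** There are finitely many choices of [act]; summing over all of them gives a bound independent of
    [mu]. *)
Lemma Theta_inv_bound : exists2 T : R, 0 <= T &
  forall act : 'I_Q -> @constr Q J,
    \sum_q \sum_k `|invmx (Theta theta mus act) q k| <= T.
Proof.
pose F (a : {ffun 'I_Q -> @constr Q J}) := \sum_q \sum_k `|invmx (Theta theta mus a) q k|.
have F0 a : 0 <= F a by do 2!apply: sumr_ge0 => ? _.
exists (\sum_a F a); first by apply: sumr_ge0 => a _.
move=> act; rewrite (bigD1 [ffun k => act k]) //=.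
have -> : F [ffun k => act k] = \sum_q \sum_k `|invmx (Theta theta mus act) q k|.
  by rewrite /F (_ : ([ffun k => act k] : 'I_Q -> _) = act) //; apply/funext => k; rewrite ffunE.
by rewrite lerDl; apply: sumr_ge0 => a _.
Qed.

(** The entries of an orthonormal [U] are bounded, hence so are the matrices [beta_mx] and, by
    [eig_nrm], their eigenvalues. *)
Lemma psi_tilde_bound l r (vs : 'I_J -> 'M[C]_(N, l)) : (0 < l)%N ->
  exists2 B : R, 0 <= B & forall (U : 'M[C]_(N, r)) act, orthonormal_cols U ->
    forall k, `|psi_tilde A theta mus vs U act k 0| <= B.
Proof.
move=> l0; pose c : R := (N * r)%:R; have c0 : 0 <= c by rewrite ler0n.
pose L (j : 'I_J) := eig_diag (Amu (mus j)) l - (lambda_min (Amu (mus j)))%:C%:M.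
pose S (j : 'I_J) := eig_diag (Amu (mus j)) l - (eig (Amu (mus j)) l.+1)%:C%:M.
pose Bj j := nrm (L j) + nrm (vs j) * c * c * nrm (vs j) * nrm (S j).
have Bj0 j : 0 <= Bj j by rewrite addr_ge0 ?mulr_ge0 ?nrm_ge0.
pose B1 := \sum_c `|constr_rhs A theta mus c|.
have B10 : 0 <= B1 by exact: sumr_ge0.
have B1le x : `|constr_rhs A theta mus x| <= B1.
  by rewrite /B1 (bigD1 x) //= lerDl sumr_ge0.
have B20 : 0 <= \sum_j Bj j by apply: sumr_ge0.
exists (B1 + \sum_j Bj j); first by rewrite addr_ge0.
move=> U act hU k; rewrite mxE; case hk : (act k) => [x|j].
  by rewrite -(addr0 `|_|) lerD.
apply: le_trans (ler_normD _ _) _; apply: lerD; first exact: (B1le (inr j)).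
apply: (@le_trans _ _ (Bj j)); last first.
  by rewrite (bigD1 j) //= lerDl sumr_ge0.
apply: le_trans (eig_nrm _ _ _) _ => //; rewrite /beta_mx /Bj.
apply: le_trans (nrmB _ _) _; rewrite lerD2l.
apply: le_trans (nrmM _ _) _; rewrite ler_wpM2r ?nrm_ge0 //.
apply: le_trans (nrmM _ _) _; rewrite ler_wpM2r ?nrm_ge0 //.
apply: le_trans (nrmM _ _) _; rewrite nrm_adj ler_pM ?nrm_ge0 ?nrm_ortho //.
by apply: le_trans (nrmM _ _) _; rewrite nrm_adj ler_pM ?nrm_ge0 ?nrm_ortho.
Qed.

Lemma nrm_Amu_dist mu nu :
  nrm (Amu mu - Amu nu) <= (\sum_q nrm (A q)) * theta_dist mu nu.
Proof.
rewrite /Defs.Amu -sumrB; apply: le_trans (nrm_sum _) _.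
rewrite mulr_suml ler_sum // => q _; rewrite -scalerBl nrmZ -rmorphB normc_real.
rewrite mulrC ler_wpM2l ?nrm_ge0 // /theta_dist (bigD1 q) //= lerDl.
exact: sumr_ge0.
Qed.

Lemma lambda_min_projected_le d (V : 'M[C]_(N, d)) (v : 'cV[C]_N) mu :
  (forall q, A q \is hermsymmx) -> orthonormal_cols V -> V *m (V^t* *m v) = v ->
  ip v v = 1 -> lambda_min (projected A theta V mu) <= ip v (Amu mu *m v).
Proof.
move=> hA hV Vv v1; have hM : projected A theta V mu \is hermsymmx.
  exact/herm_congr/Amu_herm.
have := ip_lambda_min (V^t* *m v) hM.
by rewrite -(ip_isometry _ _ hV) Vv v1 mulr1 /projected -!mulmxA Vv -ip_mulmxl Vv.
Qed.

Lemma lambda_min_le_projected d (V : 'M[C]_(N, d)) mu :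
  (forall q, A q \is hermsymmx) -> orthonormal_cols V -> (0 < d)%N ->
  lambda_min (Amu mu) <= lambda_min (projected A theta V mu).
Proof.
move=> hA hV d0; have [x x0 hx] := @eig_rayleigh _ _ (projected A theta V mu) 1 isT d0.
have := ip_lambda_min (V *m x) (Amu_herm theta mu hA).
rewrite ip_isometry // ip_mulmxl -[X in _ <= X -> _]/(ip x _).
have -> : V^t* *m (Amu mu *m (V *m x)) = projected A theta V mu *m x.
  by rewrite /projected !mulmxA.
by rewrite hx ler_pM2r.
Qed.

End LocalBound.

(** * Second-order estimate at a sample point *)

Section MainEstimate.
Local Open Scope sesquilinear_scope.
Local Open Scope complex_scope.
Context {R : realType} {P Q N J l r d : nat}.
Local Notation C := (R[i]).

Lemma le_sum4 (a b c e m : R) : 0 <= a -> 0 <= b -> 0 <= c -> 0 <= e ->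
  a + b + c + e <= m -> [/\ a <= m, b <= m & a + c + e <= m].
Proof. by move=> *; split; lra. Qed.

(** Here [eta >= lam + g - p - p'] and [lV <= lam + a]; the total loss is at most half of [g]. *)
Lemma eta_gap_scalar (a p q p' lam g phi lV beta eta : R) :
  lV <= phi -> phi <= lam + a -> g - p <= beta -> `|eta - (lam + beta)| <= q ->
  q <= p' -> a + p' + p <= g / 2 -> lV + g / 2 <= eta.
Proof. by rewrite ler_norml => ? ? ? /andP[? _] *; lra. Qed.

(** Both [lmin] and [slb] lie between [phi - c1 - c2] and [phi]. *)
Lemma squeeze_scalar (phi c1 c2 rr lmin lV slb : R) :
  phi - c1 <= lmin -> lmin <= lV -> lV <= phi -> lV - rr <= slb <= lV -> rr <= c2 ->
  0 <= c1 -> 0 <= c2 -> `|slb - phi| <= c1 + c2 /\ `|lmin - phi| <= c1 + c2.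
Proof.
by move=> ? ? ? /andP[? ?] ? ? ?; rewrite !ler_norml; split; apply/andP; split; lra.
Qed.

Lemma subspace_basis_fix (vs : 'I_J -> 'M[C]_(N, l)) (V : 'M[C]_(N, d)) j :
  subspace_basis vs V -> V *m (V^t* *m vs j) = vs j.
Proof.
move=> [hV hsp]; have : ((vs j)^T <= V^T)%MS.
  rewrite hsp; apply: submx_trans (sumsmx_sup j _ (submx_refl _)) => //.
  by rewrite genmxE.
case/submxP => H hH; have -> : vs j = V *m H^T.
  by apply: trmx_inj; rewrite trmx_mul trmxK.
by rewrite [V^t* *m _]mulmxA hV mul1mx.
Qed.

(** [U] and [V *m W] are orthonormal bases of the same space and differ by a unitary factor, which
    leaves the projector unchanged and multiplies the residual on the right. *)
Lemma rho_bound (A : 'I_Q -> 'M[C]_N) (theta : 'I_Q -> 'rV[R]_P -> R) mu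
    (V : 'M[C]_(N, d)) (W : 'M[C]_(d, r)) (U : 'M[C]_(N, r)) :
  (0 < r)%N -> orthonormal_cols V -> ritz_basis A theta V mu W U ->
  let U' := V *m W in let M := Amu A theta mu in
  U *m U^t* = U' *m U'^t* /\
  rho A theta U mu ^+ 2 <= ((r * r)%:R * nrm (M *m U' - U' *m (U'^t* *m M *m U'))) ^+ 2.
Proof.
move=> r0 hV [hW hU hUW] U' M.
have hU' : orthonormal_cols U'.
  by rewrite /orthonormal_cols adjM -mulmxA [V^t* *m _]mulmxA hV mul1mx hW.1.
have [|G UE hG] := ortho_submx hU hU' _; first by rewrite hUW.
split.
  by rewrite UE adjM -mulmxA [G *m _]mulmxA unitary_of_ortho // mul1mx.
apply: le_trans (spectral_norm_sq _ r0) _; rewrite -/M UE residual_basis //.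
rewrite ler_pXn2r ?nnegrE ?mulr_ge0 ?nrm_ge0 ?ler0n //.
apply: le_trans (nrmM _ _) _; rewrite mulrC ler_wpM2r ?nrm_ge0 //.
exact: nrm_ortho.
Qed.

(** The vector [c] is the Rayleigh point of the eigenvector at [mus i], so both bounds share one
    approximation that is linear in [theta]. *)
Lemma slb_lmin_estimate (D : set 'rV[R]_P) (A : 'I_Q -> 'M[C]_N)
  (theta : 'I_Q -> 'rV[R]_P -> R) (mus : 'I_J -> 'rV[R]_P)
  (vs : 'I_J -> 'M[C]_(N, l)) (V : 'M[C]_(N, d))
  (W : 'rV[R]_P -> 'M[C]_(d, r)) (U : 'rV[R]_P -> 'M[C]_(N, r))
  (y : 'rV[R]_P -> 'cV[R]_Q) (act : 'rV[R]_P -> 'I_Q -> @constr Q J)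
  (i : 'I_J) :
  (forall q, A q \is hermsymmx) ->
  (l < N)%N -> (0 < r)%N -> (r <= d)%N -> (r <= l)%N ->
  (forall j, smallest_eigvecs (Amu A theta (mus j)) (vs j)) ->
  subspace_basis vs V ->
  (forall mu, D mu -> ritz_basis A theta V mu (W mu) (U mu)) ->
  simple_nondegenerate A theta mus ->
  (forall mu, D mu -> LP_vertex A theta mus mu (y mu)) ->
  (forall mu, D mu -> active_enum A theta mus (y mu) (act mu)) ->
  simple_eigenvalue (Amu A theta (mus i)) (lambda_min (Amu A theta (mus i))) ->
  eig (Amu A theta (mus i)) r < eig (Amu A theta (mus i)) r.+1 ->
  exists c : 'cV[R]_Q, exists t, exists K : R, [/\ 0 < t, 0 <= K &
    forall mu, D mu -> theta_dist theta mu (mus i) < t ->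
      `|lambda_SLB A theta mus vs V (U mu) (act mu) mu - (theta_row theta mu *m c) 0 0|
        <= K * theta_dist theta mu (mus i) ^+ 2 /\
      `|lambda_min (Amu A theta mu) - (theta_row theta mu *m c) 0 0|
        <= K * theta_dist theta mu (mus i) ^+ 2].
Proof.
move=> hA lN r0 rd rl hvs hV hUW hs hLP hact hsimple hgap.
have l0 : (0 < l)%N := leq_trans r0 rl.
have d0 : (0 < d)%N := leq_trans r0 rd.
have N1 : (1 < N)%N by exact: leq_trans lN.
set x0 := mus i; set A0 := Amu A theta x0.
have hA0 : A0 \is hermsymmx by exact: Amu_herm.
(* The first column of [vs i]; being taken from [vs i], it lies in the range of [V]. *)
pose v := vs i *m (pid_mx 1 : 'M[C]_(l, 1)).
have hv : smallest_eigvecs A0 v by exact: smallest_eigvecs_sub (hvs i).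
pose X := vs i *m (pid_mx r : 'M[C]_(l, r)).
have hX : smallest_eigvecs A0 X by exact: smallest_eigvecs_sub (hvs i).
have VVi := subspace_basis_fix i hV.
have VX : V *m (V^t* *m X) = X by rewrite /X !(mulmxA _ (vs i)) mulmxA VVi.
have Vv : V *m (V^t* *m v) = v by rewrite /v !(mulmxA _ (vs i)) mulmxA VVi.
have v1 : ip v v = 1 by rewrite /ip hv.1 /mxtrace big_ord1 mxE eqxx.
pose c := rayleigh_point A v.
pose g1 := eig A0 2 - lambda_min A0.
have g1_gt0 : 0 < g1 by rewrite subr_gt0; exact: simple_eigenvalue_gap.
pose g := eig A0 r.+1 - eig A0 r.
have g_gt0 : 0 < g by rewrite subr_gt0.
have rN : (r < N)%N := leq_ltn_trans rl lN.
have [|K1 K1_ge0 hK1] := ritz_perturb hA0 r0 rN rd hX hV.1 VX g_gt0.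
  by rewrite addrC subrK.
have [Kc Kc_ge0 hKc] := coord_perturb (hvs i).1 rl.
have [T T_ge0 hT] := Theta_inv_bound theta mus.
have [B B_ge0 hB] := psi_tilde_bound A theta mus r vs l0.
pose KA := \sum_q nrm (A q).
have KA_ge0 : 0 <= KA by apply: sumr_ge0 => q _; exact: nrm_ge0.
pose S := eig_diag A0 l - (eig A0 l.+1)%:C%:M.
have S_ge0 : 0 <= nrm S by exact: nrm_ge0.
have vA0v : ip v (A0 *m v) = lambda_min A0.
  rewrite hv.2 /eig_diag mul_mx_diag.
  rewrite (_ : \matrix_(_, _) _ = (lambda_min A0)%:C *: v) ?ipZr ?v1 ?mulr1 //.
  by apply/matrixP => a b; rewrite !mxE mulrC ord1.
have tight : (theta_row theta x0 *m c) 0 0 = lambda_min A0.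
  by rewrite theta_rayleigh.
have [t0 t0_gt0 ht0] := sample_constraint_active hs hLP hact
  (rayleigh_point_feasible theta mus hA v1) tight.
(* The summands are the first-order constants for [A(mu) - A0], for the Ritz space, for [eta] and
   for [beta]. *)
pose Kt := KA + K1 * KA + T * B + Kc * (K1 * KA) * nrm S.
have Kt1 : 0 < 1 + Kt by rewrite /Kt ltr_pwDl // ?addr_ge0 ?mulr_ge0.
(* The thresholds serve [lambda_min_perturb] ([g1 / 4]), [ritz_perturb] and the gap below [eta]
   ([g / 2]), and [coord_perturb] ([1]). *)
pose m := Num.min (Num.min (g1 / 4) (g / 2)) 1.
have m_gt0 : 0 < m by rewrite !lt_min !divr_gt0 // ltr01.
(* The first summand of the constant comes from [lambda_min_perturb], the second from [slb_scalar]
   with [dl = g / 2] and the residual bound. *)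
exists c, (Num.min t0 (m / (1 + Kt))), (2 / g1 * KA ^+ 2 + 4 / g * ((r * r)%:R * (K1 * KA)) ^+ 2).
have C1_ge0 : 0 <= 2 / g1 * KA ^+ 2 by rewrite mulr_ge0 ?sqr_ge0 // divr_ge0 // ltW.
have C2_ge0 : 0 <= 4 / g * ((r * r)%:R * (K1 * KA)) ^+ 2.
  by rewrite mulr_ge0 ?sqr_ge0 // divr_ge0 // ltW.
split; [by rewrite lt_min t0_gt0 divr_gt0|by rewrite addr_ge0|].
move=> mu Dmu; rewrite lt_min => /andP[e_t0]; set e := theta_dist theta mu (mus i).
have e_ge0 : 0 <= e by exact: theta_dist_ge0.
rewrite ltr_pdivlMr // => e_m.
have e_small : KA * e + K1 * KA * e + T * B * e + Kc * (K1 * KA) * nrm S * e <= m.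
  apply: le_trans (ltW e_m).
  rewrite [leRHS](_ : _ = e + (KA * e + K1 * KA * e + T * B * e + Kc * (K1 * KA) * nrm S * e)).
    by rewrite lerDr.
  by rewrite /Kt; ring.
have p1 : 0 <= KA * e by rewrite mulr_ge0.
have p2 : 0 <= K1 * KA * e by rewrite !mulr_ge0.
have p3 : 0 <= T * B * e by rewrite !mulr_ge0.
have p4 : 0 <= Kc * (K1 * KA) * nrm S * e by rewrite !mulr_ge0.
have [m1 m2 m3] : [/\ m <= g1 / 4, m <= g / 2 & m <= 1].
  by rewrite /m !ge_min !lexx !orbT.
have [s1 s2 s3] := le_sum4 p1 p2 p3 p4 e_small.
set A1 := Amu A theta mu.
have nE : nrm (A1 - A0) <= KA * e by exact: nrm_Amu_dist.
have hA1 : A1 \is hermsymmx by exact: Amu_herm.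
have phiE : (theta_row theta mu *m c) 0 0 = ip v (A1 *m v) by exact: theta_rayleigh.
set phi := (_ *m c) 0 0 in phiE *.
have nE_ge0 := nrm_ge0 (A1 - A0).
have nE2 : nrm (A1 - A0) ^+ 2 <= KA ^+ 2 * e ^+ 2.
  by rewrite -exprMn ler_pXn2r ?nnegrE.
have lmin_ge : phi - 2 / g1 * KA ^+ 2 * e ^+ 2 <= lambda_min A1.
  have gap1 : lambda_min A0 + g1 <= eig A0 2 by rewrite /g1 addrC subrK.
  have nE4 : nrm (A1 - A0) <= g1 / 4 := le_trans nE (le_trans s1 m1).
  rewrite phiE; apply: le_trans (lambda_min_perturb hA0 hA1 N1 hv g1_gt0 gap1 nE4).
  by rewrite lerD2l lerN2 -[leRHS]mulrA ler_wpM2l // divr_ge0 // ltW.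
set lV := lambda_min (projected A theta V mu).
have lV_le : lV <= phi by rewrite phiE; exact: lambda_min_projected_le hV.1 Vv v1.
have lV_ge : lambda_min A1 <= lV by exact: lambda_min_le_projected hV.1 d0.
have [hW hU _] := hUW _ Dmu.
have [UU rho2'] := rho_bound r0 hV.1 (hUW _ Dmu).
have rho2 : rho A theta (U mu) mu ^+ 2 <= ((r * r)%:R * nrm (A1 *m (V *m W mu) -
    (V *m W mu) *m ((V *m W mu)^t* *m A1 *m (V *m W mu)))) ^+ 2 by exact: rho2'.
have [nZ nRes] := hK1 A1 (W mu) hA1 hW (le_trans nE (le_trans s1 m2)).
have nRes' : nrm (A1 *m (V *m W mu) - (V *m W mu) *m ((V *m W mu)^t* *m A1 *m (V *m W mu)))
    <= K1 * KA * e.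
  by apply: le_trans nRes _; rewrite -mulrA ler_wpM2l.
have hU' : orthonormal_cols (V *m W mu).
  by rewrite /orthonormal_cols adjM -mulmxA [V^t* *m _]mulmxA hV.1 mul1mx hW.1.
have nZ' : nrm (V *m W mu - X *m (X^t* *m (V *m W mu))) <= K1 * KA * e.
  by apply: le_trans nZ _; rewrite -mulrA ler_wpM2l.
have nM : nrm ((vs i)^t* *m U mu *m (U mu)^t* *m vs i - pid_mx r) <= Kc * (K1 * KA) * e.
  (* The matrix depends on the basis only through the projector, so [V *m W mu] may replace
     [U mu]. *)
  rewrite -[_ *m U mu *m _]mulmxA UU [(vs i)^t* *m (_ *m _)]mulmxA.
  apply: le_trans (hKc _ hU' (le_trans nZ' (le_trans s2 m3))) _.
  by rewrite -mulrA ler_wpM2l.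
have beta_ge : g - Kc * (K1 * KA) * nrm S * e <= Defs.beta A theta mus vs (U mu) i.
  apply: le_trans (beta_diag_lower _ r0 rl lN (lexx _) (erefl _)).
  rewrite -/A0 -/S -/g lerD2l lerN2 [leRHS]mulrAC ler_wpM2r //.
have [k hk] := ht0 _ Dmu e_t0.
have hTheta := Theta_unit hs (hLP _ Dmu).1 (hact _ Dmu).
have eta_near := eta_estimate A vs (U mu) mu hTheta hk.
have eta_err : theta_dist theta mu (mus i) * (\sum_q `|(invmx (Theta theta mus (act mu)) *m
    psi_tilde A theta mus vs (U mu) (act mu)) q 0|) <= T * B * e.
  rewrite mulrC; apply: ler_wpM2r => //.
  by apply: le_trans (sum_mulmx_le _ (hB (U mu) (act mu) hU)) _; rewrite ler_wpM2r.
have phi_le : phi <= lambda_min A0 + KA * e.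
  have A1E : A1 = A0 + (A1 - A0) by rewrite addrCA subrr addr0.
  rewrite phiE A1E mulmxDl ipDr vA0v lerD2l; apply: le_trans (ler_norm _) _.
  apply: le_trans (ip_col_nrm _ _ _) _.
  by rewrite -expr2 sqr_fnorm v1 mulr1.
have gap_eta : lV + g / 2 <= Defs.eta A theta mus vs (U mu) (act mu) mu :=
  eta_gap_scalar lV_le phi_le beta_ge eta_near eta_err (le_trans s3 m2).
have slb_lV := slb_scalar (rho A theta (U mu) mu) (divr_gt0 g_gt0 (ltr0Sn _ 1)) gap_eta.
have rho_e : 2 / (g / 2) * rho A theta (U mu) mu ^+ 2 <=
    4 / g * ((r * r)%:R * (K1 * KA)) ^+ 2 * e ^+ 2.
  have -> : 2 / (g / 2) = 4 / g by field; rewrite gt_eqF.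
  have g4 : 0 <= 4 / g by rewrite divr_ge0 // ltW.
  rewrite -[leRHS]mulrA ler_wpM2l // -exprMn -[X in _ <= X ^+ 2]mulrA.
  apply: le_trans rho2 _; rewrite ler_pXn2r ?nnegrE ?mulr_ge0 ?nrm_ge0 ?ler0n //.
  by apply: ler_wpM2l; [exact: ler0n | exact: nRes'].
have e2 := sqr_ge0 e.
have c1 : 0 <= 2 / g1 * KA ^+ 2 * e ^+ 2 by rewrite mulr_ge0.
have c2 : 0 <= 4 / g * ((r * r)%:R * (K1 * KA)) ^+ 2 * e ^+ 2 by rewrite mulr_ge0.
rewrite mulrDl; exact: squeeze_scalar lmin_ge lV_ge lV_le slb_lV rho_e c1 c2.
Qed.

End MainEstimate.

(** * Transfer of derivatives *)

Section Differentiability.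
Context {R : realType} {V : normedModType R}.

Lemma differentiable_local_lipschitz (f : V -> R) x : differentiable f x ->
  exists2 k : R, 0 <= k & \forall z \near x, `|f z - f x| <= k * `|z - x|.
Proof.
move=> df; have [k k0 hk] := linear_lipschitz (diff_continuous df).
(* [k] bounds the differential, and 1 the remainder near [x]. *)
exists (k + 1); first by rewrite addr_ge0 // ltW.
have /eqaddoP/(_ 1 ltr01) := diff_locally df.
move=> h; apply/nbhs0P; apply: filterS h => h /=; rewrite !fctE /= mul1r => hle.
rewrite [x + h]addrC addrK.
have -> : f (h + x) - f x = (f (h + x) - (f x + 'd f x h)) + 'd f x h.
  by rewrite opprD addrA subrK.
by apply: le_trans (ler_normD _ _) _; rewrite mulrDl mul1r addrC lerD.
Qed.

(** A quadratic error is negligible to first order, so [f] inherits the affine approximation of [g];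
    uniqueness of the differential concludes. *)
Lemma differentiable_second_order (f g : V -> R) x (k : R) : differentiable g x ->
  (\forall z \near x, `|f z - g z| <= k * `|z - x| ^+ 2) ->
  differentiable f x /\ 'd f x = 'd g x :> (V -> R).
Proof.
move=> dg hfg.
have fgx : f x = g x.
  have := nbhs_singleton hfg; rewrite subrr normr0 expr0n /= mulr0 normr_le0 subr_eq0.
  by move=> /eqP.
have key : f \o shift x = cst (f x) + 'd g x +o_ 0 id.
  apply/eqaddoP => e e0.
  have /eqaddoP/(_ (e / 2) (divr_gt0 e0 (ltr0Sn _ 1))) := diff_locally dg.
  move=> hg; have {}hfg := (nbhs0P _ _).1 hfg.
  (* On this radius the quadratic error is at most [e / 2] times the norm of [h]; adding 1 keeps the
     denominator positive. *)
  pose dl := e / 2 / (1 + `|k|).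
  have dl0 : 0 < dl by rewrite !divr_gt0 // ltr_pwDl.
  have hb : \forall h \near (0 : V), `|h| <= dl.
    by apply: filterS (nbhs0_lt dl0) => h; exact: ltW.
  apply: filterS3 hb hfg hg => h /= hb hfg; rewrite !fctE /= => hg.
  have -> : f (h + x) - (f x + 'd g x h) =
      (f (h + x) - g (h + x)) + (g (h + x) - (g x + 'd g x h)).
    by rewrite fgx addrA subrK.
  apply: le_trans (ler_normD _ _) _; rewrite [e in leRHS]splitr mulrDl lerD //.
  move: hfg; rewrite [x + h]addrC addrK => /le_trans; apply.
  rewrite expr2 mulrA ler_wpM2r //; apply: (@le_trans _ _ ((1 + `|k|) * dl)).
    by rewrite (le_trans (ler_norm _)) // normrM normr_id ler_pM // lerDr.
  by rewrite /dl mulrC divfK // gt_eqF // ltr_pwDl.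
have dfg := diff_unique (diff_continuous dg) key.
split => //; apply/diff_locallyP; rewrite dfg; split => //.
exact: diff_continuous.
Qed.

End Differentiability.

Lemma differentiable_theta_dot (R : realType) (P Q : nat)
  (theta : 'I_Q -> 'rV[R]_P -> R) (c : 'cV[R]_Q) x :
  (forall q, differentiable (theta q) x) ->
  differentiable (fun mu => (theta_row theta mu *m c) 0 0) x.
Proof.
move=> hd.
rewrite (_ : (fun mu => _) = \sum_(q < Q) (c q 0 *: theta q)); last first.
  apply/funext => mu; rewrite theta_row_dot fct_sumE; apply: eq_bigr => q _.
  by rewrite mulrC.
by apply: differentiable_sum => q; apply: differentiableZ.
Qed.

Lemma theta_dist_lipschitz (R : realType) (P Q : nat)
  (theta : 'I_Q -> 'rV[R]_P -> R) x :
  (forall q, differentiable (theta q) x) ->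
  exists2 k : R, 0 <= k & \forall mu \near x, theta_dist theta mu x <= k * `|mu - x|.
Proof.
move=> hd; have /choice[k hk] : forall q, exists k : R, 0 <= k /\
    \forall mu \near x, `|theta q mu - theta q x| <= k * `|mu - x|.
  by move=> q; have [k] := differentiable_local_lipschitz (hd q); exists k.
exists (\sum_q k q); first by apply: sumr_ge0 => q _; have [] := hk q.
have : \forall mu \near x, forall q, `|theta q mu - theta q x| <= k q * `|mu - x|.
  apply: (@filter_forall _ _ (fun q mu => `|theta q mu - theta q x| <= k q * `|mu - x|) _
    (nbhs_filter x)).
  by move=> q; exact: (hk q).2.
by apply: filterS => mu h; rewrite mulr_suml ler_sum.
Qed.

Theorem theorem3p6 (R : realType) (P Q N J l r d : nat)
  (D : set 'rV[R]_P) (A : 'I_Q -> 'M[R[i]]_N)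
  (theta : 'I_Q -> 'rV[R]_P -> R) (mus : 'I_J -> 'rV[R]_P)
  (vs : 'I_J -> 'M[R[i]]_(N, l)) (V : 'M[R[i]]_(N, d))
  (W : 'rV[R]_P -> 'M[R[i]]_(d, r)) (U : 'rV[R]_P -> 'M[R[i]]_(N, r))
  (y : 'rV[R]_P -> 'cV[R]_Q) (act : 'rV[R]_P -> 'I_Q -> @constr Q J)
  (i : 'I_J) :
  compact D ->
  (forall q, A q \is hermsymmx) ->
  (forall j, D (mus j)) ->
  (1 <= l)%N -> (l.+1 <= N)%N ->
  (1 <= r)%N -> (r <= d)%N -> (r < N)%N ->
  (forall j, smallest_eigvecs (Amu A theta (mus j)) (vs j)) ->
  subspace_basis vs V ->
  (forall mu, D mu -> ritz_basis A theta V mu (W mu) (U mu)) ->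
  simple_nondegenerate A theta mus ->
  (forall mu, D mu -> LP_vertex A theta mus mu (y mu)) ->
  (forall mu, D mu -> active_enum A theta mus (y mu) (act mu)) ->
  (forall mu, D mu -> exists k, exists j, act mu k = inr j) ->
  interior D (mus i) ->
  (forall q, differentiable (theta q) (mus i)) ->
  simple_eigenvalue (Amu A theta (mus i)) (lambda_min (Amu A theta (mus i))) ->
  (r <= l)%N ->
  eig (Amu A theta (mus i)) r < eig (Amu A theta (mus i)) r.+1 ->
  let slb mu := lambda_SLB A theta mus vs V (U mu) (act mu) mu in
  let lmin mu := lambda_min (Amu A theta mu) in
  [/\ differentiable slb (mus i), differentiable lmin (mus i)
    & grad slb (mus i) = grad lmin (mus i)].
Proof.
move=> _ hA _ _ lN r0 rd _ hvs hV hUW hs hLP hact _ Dint hd hsimple rl hgap slb lmin.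
have [c [t [K [t0 K0 hK]]]] :=
  slb_lmin_estimate hA lN r0 rd rl hvs hV hUW hs hLP hact hsimple hgap.
pose phi mu := (theta_row theta mu *m c) 0 0.
have dphi : differentiable phi (mus i) by exact: differentiable_theta_dot.
have [k k0 hk] := theta_dist_lipschitz hd.
have near_t : \forall mu \near mus i, theta_dist theta mu (mus i) < t.
  have dl0 : 0 < t / (1 + k) by rewrite divr_gt0 // ltr_pwDl.
  have hball : \forall mu \near mus i, `|mu - mus i| < t / (1 + k).
    by apply/nbhs0P; apply: filterS (nbhs0_lt dl0) => h; rewrite [mus i + h]addrC addrK.
  apply: filterS2 hk hball => mu hmu; rewrite ltr_pdivlMr ?ltr_pwDl // => hlt.
  apply: le_lt_trans hmu (le_lt_trans _ hlt).
  by rewrite mulrC ler_wpM2l // lerDr.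
(* The estimates hold on [D] only; [mus i] being interior makes them valid in a neighbourhood. *)
have est f : (forall mu, D mu -> theta_dist theta mu (mus i) < t ->
    `|f mu - phi mu| <= K * theta_dist theta mu (mus i) ^+ 2) ->
    differentiable f (mus i) /\ 'd f (mus i) = 'd phi (mus i) :> ('rV[R]_P -> R).
  move=> hf; apply: (@differentiable_second_order _ _ _ _ _ (K * k ^+ 2)) => //.
  apply: filterS3 Dint near_t hk => mu Dmu tmu kmu.
  apply: le_trans (hf _ Dmu tmu) _; rewrite -mulrA ler_wpM2l // -exprMn.
  by rewrite ler_pXn2r // nnegrE ?theta_dist_ge0 // mulr_ge0.
have [dslb eslb] := est slb (fun mu Dmu tmu => (hK mu Dmu tmu).1).
have [dlmin elmin] := est lmin (fun mu Dmu tmu => (hK mu Dmu tmu).2).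
split=> //; apply/rowP => j.
by rewrite !mxE (deriveE _ dslb) (deriveE _ dlmin) eslb elmin.
Qed.
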